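(* Let $n=1$. There exist constants $C_1, C_2>0$ (depending only on the space dimension, hence absolute constants, independent of the initial data and of $t$) such that for every $[u_0,u_1]\in H^1(\mathbf{R})\times L^2(\mathbf{R})$ the weak solution $u(t,x)$ of the Cauchy problem $$u_{tt}-u_{xx}=0 \ \text{ in } (0,\infty)\times\mathbf{R},\qquad u(0,x)=u_0(x),\quad u_t(0,x)=u_1(x),$$ satisfies the following: (i) if $[u_0,u_1]\in L^1(\mathbf{R})\times L^1(\mathbf{R})$, then $$\|u(t,\cdot)\|\le C_1 I_{0,1}\sqrt{t}\qquad\text{for } t\gg 1;$$ (ii) if $[u_0,u_1]\in L^1(\mathbf{R})\times L^{1,1}(\mathbf{R})$, then $$C_2\left|\int_{\mathbf{R}}u_1(x)\,dx\right|\sqrt{t}\le\|u(t,\cdot)\|\qquad\text{for } t\gg 1.$$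
   Context: $\|\cdot\|$ denotes the usual $L^2(\mathbf{R})$-norm. $L^{1,1}(\mathbf{R})$ is the space of $f\in L^1(\mathbf{R})$ with $\|f\|_{L^{1,1}}:=\int_{\mathbf{R}}(1+|x|)|f(x)|\,dx<\infty$. $$I_{0,1}:=\|u_0\|+\|u_0\|_{L^1(\mathbf{R})}+\|u_1\|+\|u_1\|_{L^1(\mathbf{R})}.$$ For $[u_0,u_1]\in H^1(\mathbf{R})\times L^2(\mathbf{R})$ the Cauchy problem has a unique weak solution $u\in C([0,\infty);H^1(\mathbf{R}))\cap C^1([0,\infty);L^2(\mathbf{R}))$; its spatial Fourier transform (with convention $\hat f(\xi)=\int e^{-ix\xi}f(x)\,dx$ and its $L^2$ extension) is $\hat u(t,\xi)=\frac{\sin(t|\xi|)}{|\xi|}\hat u_1(\xi)+\cos(t|\xi|)\hat u_0(\xi)$. ''For $t\gg1$'' means: there is $t_0>0$, possibly depending on the initial data, such that the inequality holds for all $t\ge t_0$. *)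

(* Defs.v *)
From HB Require Import structures.
From mathcomp Require Import all_boot all_order all_algebra.
From mathcomp Require Import all_classical all_reals all_analysis.
Set Implicit Arguments.
Unset Strict Implicit.
Unset Printing Implicit Defensive.
Import Order.TTheory GRing.Theory Num.Theory.
Import numFieldNormedType.Exports.
Local Open Scope classical_set_scope.
Local Open Scope ring_scope.

(* A function is C^oo iff all its iterated directional derivatives, of every
   order and in all directions, are (Frechet) differentiable everywhere; the
   list s gives the successive directions, and s = [::] covers f itself. *)
Definition smooth (R : realType) (V : normedModType R) (f : V -> R) : Prop :=
  forall (s : seq V) (x : V),
    differentiable (foldr (fun (v : V) (g : V -> R) => 'D_v g) f s) x.

Definition test_function (R : realType) (V : normedModType R) (Omega : set V)
    (phi : V -> R) : Prop :=
  let supp := closure [set x | phi x != 0] in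
  [/\ smooth phi, compact supp & supp `<=` Omega].

(* Elements of the Lebesgue spaces on the line are represented by measurable
   functions R -> R; nothing below depends on the choice of representatives.
   The value of Lp_norm is meaningful only on functions satisfying in_Lp. *)
Definition Lp_norm (R : realType) (p : \bar R) (f : R -> R) : R :=
  fine ('N[@lebesgue_measure R]_p[EFin \o f])%E.

Definition in_Lp (R : realType) (p : \bar R) (f : R -> R) : Prop :=
  f \in Lfun (@lebesgue_measure R) p.

Definition in_L11 (R : realType) (f : R -> R) : Prop :=
  in_Lp 1%E f /\
  (\int[@lebesgue_measure R]_x ((1 + `|x|) * `|f x|)%:E < +oo)%E.

Definition weak_derivative (R : realType) (f g : R -> R) : Prop :=
  forall phi : R -> R, test_function [set: R] phi ->
    \int[@lebesgue_measure R]_x (f x * (phi^`())%classic x)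
      = - \int[@lebesgue_measure R]_x (g x * phi x).

Definition in_H1 (R : realType) (f : R -> R) : Prop :=
  in_Lp 2%:E f /\ exists2 g : R -> R, in_Lp 2%:E g & weak_derivative f g.

Definition L2_curve_continuous (R : realType) (v : R -> R -> R) : Prop :=
  (forall t : R, 0 <= t -> in_Lp 2%:E (v t)) /\
  (forall t : R, 0 <= t ->
    Lp_norm 2%:E (v s \- v t) @[s --> within `[0, +oo[ (nbhs t)] --> (0 : R)).

(* v' is the derivative of the L^2-valued curve v on [0, +oo[, in the norm of
   L^2 (one-sided at 0). *)
Definition L2_curve_derivative (R : realType) (v v' : R -> R -> R) : Prop :=
  forall t : R, 0 <= t ->
    Lp_norm 2%:E (fun x => (s - t)^-1 * (v s x - v t x) - v' t x)
      @[s --> within `[0, +oo[ (dnbhs t)] --> (0 : R).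

(* u_tt - u_xx = 0 in the sense of distributions on ]0, +oo[ x R, whose points
   are the pairs (t, x). *)
Definition wave_equation (R : realType) (u : R -> R -> R) : Prop :=
  forall phi : R * R -> R, test_function [set p : R * R | 0 < p.1] phi ->
    \int[@lebesgue_measure R]_(t in `]0, +oo[)
      (\int[@lebesgue_measure R]_x
        (u t x * ('D_((1, 0) : R * R) ('D_((1, 0) : R * R) phi) (t, x)
                  - 'D_((0, 1) : R * R) ('D_((0, 1) : R * R) phi) (t, x)))) = 0.

(* u belongs to C([0, +oo[; H^1) and C^1([0, +oo[; L^2), where continuity in
   H^1 is continuity in L^2 of both u and its weak spatial derivative ux. *)
Definition weak_solution (R : realType) (u0 u1 : R -> R) (u : R -> R -> R) :
    Prop :=
  exists ux ut : R -> R -> R,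
  [/\ [/\ L2_curve_continuous u, L2_curve_continuous ux
        & forall t : R, 0 <= t -> weak_derivative (u t) (ux t)],
      L2_curve_continuous ut /\ L2_curve_derivative u ut,
      wave_equation u,
      {ae (@lebesgue_measure R), forall x, u 0 x = u0 x}
    & {ae (@lebesgue_measure R), forall x, ut 0 x = u1 x}].

Definition I01 (R : realType) (u0 u1 : R -> R) : R :=
  Lp_norm 2%:E u0 + Lp_norm 1%E u0 + Lp_norm 2%:E u1 + Lp_norm 1%E u1.

(* Main.v *)
Require Import Defs.
From HB Require Import structures.
From mathcomp Require Import all_boot all_order all_algebra.
From mathcomp Require Import all_classical all_reals all_analysis.
From mathcomp Require Import measurable_realfun ring lra.
Set Implicit Arguments.
Unset Strict Implicit.
Unset Printing Implicit Defensive.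
Import Order.TTheory GRing.Theory Num.Theory.
Import numFieldNormedType.Exports.
Local Open Scope classical_set_scope.
Local Open Scope ring_scope.

(* The weak solution is given by d'Alembert's formula
     u(t, x) = (u0 (x + t) + u0 (x - t)) / 2 + (1/2) int_(x - t)^(x + t) u1
   for almost every x, which is proved by duality.  Fix T > 0 and a smooth F
   whose derivative has compact support.  Then
     W(t, x) = (F (x + T - t) - F (x - T + t)) / 2
   solves the wave equation with W(T, .) = 0 and W_t(T, .) = - F'.  Testing the
   equation against theta(t) W(t, x) gives
     int theta'' <u, W> + 2 theta' <u, W_t> dt = 0
   for every bump function theta, so <u_t, W> - <u, W_t> is constant on [0, T];
   comparing t = 0 with t = T determines <u(T), F'>.

   In L^2, the first term of the formula has norm at most ||u0||, and by
   Tonelli's theorem the second one has norm at most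
   (1/2) sqrt(2 t) ||u1||_1.  For |x| <= t/2 the integral over [x - t, x + t]
   tends to int u1 uniformly in x, so that the norm of the second term is at
   least (1/4) |int u1| sqrt(t) for large t, whereas ||u0|| is bounded. *)

(** * Smooth functions *)

(** Recursion on the order of differentiation, so that closure under sums, products, inverses and
    compositions is proved by induction on [n]. *)
Fixpoint differentiable_upto {R : realType} {V : normedModType R} (n : nat)
    (f : V -> R) : Prop :=
  (forall x, differentiable f x) /\
  (if n is m.+1 then forall v, differentiable_upto m ('D_v f) else True).

Section smooth_closure.
Context {R : realType} {V : normedModType R}.
Implicit Types (f g : V -> R) (n : nat).

Lemma differentiable_upto0 n f : differentiable_upto n f ->
  forall x, differentiable f x.
Proof. by case: n => [|n] []. Qed.

Lemma differentiable_uptoS n f :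
  differentiable_upto n.+1 f -> differentiable_upto n f.
Proof.
elim: n f => [|n IH] f [df Df]; split=> // v.
exact/IH/Df.
Qed.

(** In [smooth] the last direction of the list is differentiated first. Reading the list from its
    end peels off the innermost derivative ['D_v f], which is the recursion of
    [differentiable_upto]. *)
Lemma smooth_upto f : smooth f <-> forall n, differentiable_upto n f.
Proof.
split=> [sf n|Hf].
  elim: n f sf => [|n IH] f sf; first by split=> // x; exact: (sf [::] x).
  split=> [x|v]; first exact: (sf [::] x).
  by apply: IH => s x; have := sf (rcons s v) x; rewrite foldr_rcons.
move=> s; elim/last_ind: s f Hf => [|s v IH] f Hf x.
  exact: (differentiable_upto0 (Hf 0%N)).
by rewrite foldr_rcons; apply: IH => n; exact: (proj2 (Hf n.+1) v).
Qed.

Lemma smooth_differentiable f : smooth f -> forall x, differentiable f x.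
Proof. by move=> sf x; have := sf [::] x. Qed.

Lemma smooth_derive f v : smooth f -> smooth ('D_v f).
Proof. by move=> /smooth_upto sf; apply/smooth_upto => n;
  exact: (proj2 (sf n.+1) v). Qed.

Lemma differentiable_upto_cst n (a : R) : differentiable_upto n (cst a : V -> R).
Proof.
elim: n a => [|n IH] a; split=> // v.
rewrite (_ : 'D_v _ = cst 0); first exact: IH.
by apply/funext => x; rewrite derive_cst.
Qed.

Lemma differentiable_uptoD n f g : differentiable_upto n f ->
  differentiable_upto n g -> differentiable_upto n (f + g).
Proof.
elim: n f g => [|n IH] f g [df Df] [dg Dg]; split=> //;
  try (by move=> x; exact: differentiableD); move=> v.
rewrite (_ : 'D_v _ = 'D_v f + 'D_v g); first exact: IH (Df v) (Dg v).
by apply/funext => x; rewrite deriveD//; exact: diff_derivable.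
Qed.

Lemma differentiable_uptoM n f g : differentiable_upto n f ->
  differentiable_upto n g -> differentiable_upto n (f * g).
Proof.
elim: n f g => [|n IH] f g Hf Hg; move: (Hf) (Hg) => [df Df] [dg Dg];
  split=> //;
  try (by move=> x; exact: differentiableM); move=> v.
rewrite (_ : 'D_v _ = f * 'D_v g + g * 'D_v f).
  apply: differentiable_uptoD; apply: IH; do ?exact: differentiable_uptoS.
    exact: (Dg v).
  exact: (Df v).
by apply/funext => x; rewrite deriveM//; exact: diff_derivable.
Qed.

(** The derivative - f^-2 D_v f involves only [D_v f] and the inverse itself at one order less, so
    products and the induction hypothesis suffice. *)
Lemma differentiable_uptoV n f : (forall x, f x != 0) ->
  differentiable_upto n f -> differentiable_upto n (fun x => (f x)^-1).
Proof.
move=> f0; elim: n => [|n IH] Hf; have [df Df] := Hf; split=> //;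
  try (by move=> x; exact: differentiableV); move=> v.
have Hi := IH (differentiable_uptoS Hf).
rewrite (_ : 'D_v _ = cst (- 1) * (fun x => (f x)^-1) * (fun x => (f x)^-1) * 'D_v f).
  apply: differentiable_uptoM (Df v); apply: differentiable_uptoM (Hi).
  apply: differentiable_uptoM (Hi).
  exact: differentiable_upto_cst.
apply/funext => x; rewrite deriveV//; last exact: diff_derivable.
by rewrite /GRing.mul/= expr2 invfM /GRing.scale/= !mulNr !mul1r.
Qed.

Lemma derive_comp_line (g : R -> R) (l : V -> R) (x v : V) :
  differentiable g (l x) -> differentiable l x ->
  'D_v (g \o l) x = 'D_v l x * 'D_1 g (l x).
Proof.
move=> dg dl; rewrite deriveE; last exact: differentiable_comp.
rewrite diff_comp//= !deriveE//.
by rewrite -[X in 'd g _ X = _]mulr1 [LHS]linearZ.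
Qed.

(** Because the derivative [c v] of [l] does not depend on the point, the chain rule gives a
    constant times ['D_1 g \o l], again of the form to which the induction applies. *)
Lemma differentiable_upto_comp n (g : R -> R) (l : V -> R) (c : V -> R) :
  (forall x, differentiable l x) -> (forall x v, 'D_v l x = c v) ->
  differentiable_upto n g -> differentiable_upto n (g \o l).
Proof.
move=> dl lc; elim: n g => [|n IH] g [dg Dg]; split=> //;
  try (by move=> x; exact: differentiable_comp); move=> v.
rewrite (_ : 'D_v _ = cst (c v) * ('D_1 g \o l)).
  by apply: differentiable_uptoM; [exact: differentiable_upto_cst|exact: IH (Dg 1)].
by apply/funext => x; rewrite derive_comp_line// lc.
Qed.

Lemma smooth_cst (a : R) : smooth (cst a : V -> R).
Proof. by apply/smooth_upto => n; exact: differentiable_upto_cst. Qed.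

Lemma smoothD f g : smooth f -> smooth g -> smooth (f + g).
Proof.
by rewrite !smooth_upto => sf sg n; exact: differentiable_uptoD.
Qed.

Lemma smoothM f g : smooth f -> smooth g -> smooth (f * g).
Proof.
by rewrite !smooth_upto => sf sg n; exact: differentiable_uptoM.
Qed.

Lemma smoothV f : (forall x, f x != 0) -> smooth f ->
  smooth (fun x => (f x)^-1).
Proof.
by rewrite !smooth_upto => f0 sf n; exact: differentiable_uptoV.
Qed.

End smooth_closure.

Lemma smooth_comp {R : realType} {V : normedModType R} (g : R -> R) (l : V -> R) (c :
  V -> R) :
  (forall x, differentiable l x) -> (forall x v, 'D_v l x = c v) ->
  smooth g -> smooth (g \o l).
Proof.
move=> dl lc /smooth_upto sg; apply/smooth_upto => n.
exact: differentiable_upto_comp dl lc (sg n).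
Qed.

(** * Smooth functions on the line and a smooth step *)

Section smooth_line.
Context {R : realType}.
Implicit Types (f g : R -> R) (n : nat).

Lemma derive_line f x v : differentiable f x -> 'D_v f x = v * 'D_1 f x.
Proof.
by move=> df; rewrite !deriveE// -[X in 'd f x X = _]mulr1 linearZ.
Qed.

Lemma differentiable_upto_line n f : (forall x, differentiable f x) ->
  differentiable_upto n ('D_1 f) -> differentiable_upto n.+1 f.
Proof.
move=> df Df; split=> // v.
rewrite (_ : 'D_v f = cst v * 'D_1 f).
  by apply: differentiable_uptoM => //; exact: differentiable_upto_cst.
by apply/funext => x; rewrite derive_line.
Qed.

Lemma is_derive_affine (a b x v : R) :
  is_derive x v (fun x => a * x + b) (a * v).
Proof.
have -> : (fun x => a * x + b) = (a \*: (@id R)) + cst b.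
  by apply/funext => y.
by apply: is_derive_eq; rewrite addr0.
Qed.

Lemma smooth_affine g (a b : R) : smooth g -> smooth (fun x => g (a * x + b)).
Proof.
have dl := is_derive_affine a b.
apply: (@smooth_comp R R g (fun x => a * x + b) (fun v => a * v)) => [x|x v].
  by apply/derivable1_diffP; case: (dl x 1).
by have [_] := dl x v.
Qed.

Lemma derive_affine g (a b t : R) : smooth g ->
  'D_1 (fun x => g (a * x + b)) t = a * 'D_1 g (a * t + b).
Proof.
move=> /smooth_differentiable dg; have [dl El] := is_derive_affine a b t 1.
have dl' := (derivable1_diffP _ _).1 dl.
rewrite (derive_comp_line (l := fun t => a * t + b) (g := g))//.
by rewrite El mulr1.
Qed.

(** For k = 0 this is the classical flat function exp(-1/x). The extra powers of 1/x make the span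
    of the family stable under differentiation, so that all members are proved smooth by one
    induction on the order. *)
Definition flat_exp (k : nat) (x : R) : R :=
  if 0 < x then x^-1 ^+ k * expR (- x^-1) else 0.

(** With y = 1/x, the exponential series gives e^y >= y^(k+2)/(k+2)!. The two powers beyond [k]
    leave a quadratic bound, hence derivative 0 at the origin. *)
Lemma flat_exp_le k (x : R) : 0 < x -> flat_exp k x <= k.+2`!%:R * x ^+ 2.
Proof.
move=> x0; rewrite /flat_exp x0 expRN.
have y0 : 0 < x^-1 by rewrite invr_gt0.
have := expR_ge1Dxn k.+1 (ltW y0); set E := expR _ => HE.
have E0 : 0 < E := expR_gt0 _.
have fa : 0 < k.+2`!%:R :> R by rewrite ltr0n fact_gt0.
rewrite ler_pdivrMr//.
have : x^-1 ^+ k.+2 <= k.+2`!%:R * E.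
  by rewrite mulrC -ler_pdivrMr//; apply: le_trans HE; rewrite lerDr.
have -> : x^-1 ^+ k = x ^+ 2 * x^-1 ^+ k.+2.
  by rewrite -(addn2 k) exprD mulrCA -exprMn divff ?gt_eqF// expr1n mulr1.
by move=> H; rewrite [leRHS]mulrAC [leRHS]mulrC ler_pM2l// exprn_gt0.
Qed.

Lemma flat_exp_ge0 k (x : R) : 0 <= flat_exp k x.
Proof.
rewrite /flat_exp; case: ifPn => // x0.
by rewrite mulr_ge0 ?expR_ge0// exprn_ge0// invr_ge0 ltW.
Qed.

Lemma is_derive_quadratic f (C x : R) :
  (forall y, `|f y - f x| <= C * (y - x) ^+ 2) -> is_derive x 1 f 0.
Proof.
move=> Hf.
have H : h^-1 *: (f (h *: 1 + x) - f x) @[h --> 0^'] --> (0 : R).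
  apply/cvgr0Pnorm_lt => e e0.
  have C0 : 0 <= C.
    have := le_trans (normr_ge0 _) (Hf (x + 1)).
    by rewrite addrAC subrr add0r expr1n mulr1.
  have d0 : 0 < e / (C + 1) by rewrite divr_gt0// ltr_wpDl.
  near=> h.
  have h0 : h != 0 by near: h; exact: nbhs_dnbhs_neq.
  have hd : `|h| < e / (C + 1).
    by near: h; apply: dnbhs0_lt.
  rewrite normrZ normfV mulrC ltr_pdivrMr ?normr_gt0//.
  apply: (le_lt_trans (Hf _)).
  have -> : h *: 1 + x - x = h by rewrite addrK [LHS]mulr1.
  rewrite -[h ^+ 2]ger0_norm ?sqr_ge0// normrX expr2 mulrA ltr_pM2r ?normr_gt0//.
  rewrite ltr_pdivlMr in hd; last by rewrite ltr_wpDl.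
  apply: le_lt_trans hd; rewrite mulrC ler_wpM2l// lerDl//.
by split; [apply/cvg_ex; exists 0|exact: cvg_lim H].
Unshelve. all: by end_near. Qed.

Lemma flat_exp0 k (x : R) : x <= 0 -> flat_exp k x = 0.
Proof. by rewrite /flat_exp leNgt => /negbTE ->. Qed.

Lemma is_derive_flat_exp k (x : R) :
  is_derive x 1 (flat_exp k) (flat_exp k.+2 x - k%:R * flat_exp k.+1 x).
Proof.
have [x0|x0|->] := ltgtP x 0.
- apply: (@near_eq_is_derive _ _ _ (cst 0)).
    near=> y; rewrite flat_exp0// ltW//.
    by near: y; exact: lt_nbhsl.
  rewrite !flat_exp0 ?ltW//.
  by apply: is_derive_eq; rewrite mulr0 subr0.
- apply: (@near_eq_is_derive _ _ _
    (((@GRing.inv R) ^+ k) * (expR \o (fun y => - y^-1)))).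
    near=> y; have y0 : 0 < y by near: y; exact: lt_nbhsr x0.
    by rewrite /flat_exp y0 exprfctE.
  have dV : is_derive x 1 (@GRing.inv R) (- x^-1 ^+ 2).
    split; first by apply: (derivableV (f := id)) => //; rewrite gt_eqF.
    rewrite (deriveV (f := id)) ?gt_eqF// derive_id [LHS]mulr1.
    by rewrite exprVn.
  have dN : is_derive x 1 (fun y => - y^-1) (x^-1 ^+ 2).
    by apply: is_derive_eq; rewrite opprK.
  apply: is_derive_eq.
  rewrite /flat_exp x0 /GRing.scale/= exprfctE.
  case: k => [|k]; first by rewrite !expr0; ring.
  rewrite !exprS; ring.
- rewrite !flat_exp0// mulr0 subr0.
  apply: (@is_derive_quadratic _ k.+2`!%:R) => y.
  rewrite [flat_exp _ 0]flat_exp0// !subr0 ger0_norm ?flat_exp_ge0//.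
  have [y0|y0] := leP y 0; last exact: flat_exp_le.
  by rewrite flat_exp0// mulr_ge0 ?sqr_ge0 ?ler0n.
Unshelve. all: by end_near. Qed.

Lemma smooth_flat_exp k : smooth (flat_exp k).
Proof.
apply/smooth_upto => n; elim: n k => [|n IH] k.
  by split=> // x; apply/derivable1_diffP; case: (is_derive_flat_exp k x).
apply: differentiable_upto_line => [x|].
  by apply/derivable1_diffP; case: (is_derive_flat_exp k x).
rewrite (_ : 'D_1 (flat_exp k) = flat_exp k.+2 + cst (- k%:R) * flat_exp k.+1).
  apply: differentiable_uptoD => //.
  by apply: differentiable_uptoM => //; exact: differentiable_upto_cst.
apply/funext => x; have [_ ->] := is_derive_flat_exp k x.
by rewrite -mulNr.
Qed.

Lemma smooth_id : smooth (@id R).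
Proof.
apply/smooth_upto => -[|n]; first by split=> // x; exact/derivable1_diffP/derivable_id.
apply: differentiable_upto_line => [x|]; first exact/derivable1_diffP/derivable_id.
rewrite (_ : 'D_1 (@id R) = cst 1); first exact: differentiable_upto_cst.
by apply/funext => x; rewrite derive_id.
Qed.

(** The quotient f(y) / (f(y) + f(1 - y)) with f = [flat_exp 0]. The denominator is positive because
    y or 1 - y always is. *)
Lemma smooth_step : exists S : R -> R, [/\ smooth S,
  forall y, y <= 0 -> S y = 0, forall y, 1 <= y -> S y = 1 &
  forall y, 0 <= S y <= 1].
Proof.
pose f := flat_exp 0; pose g x := f ((-1) * x + 1).
have f_gt0 x : 0 < x -> 0 < f x.
  by move=> x0; rewrite /f /flat_exp x0 expr0 mul1r expR_gt0.
have fg0 x : 0 < f x + g x.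
  have [x0|x0] := ltP 0 x.
    by rewrite ltr_wpDr// ?flat_exp_ge0// f_gt0.
  rewrite ltr_wpDl// ?flat_exp_ge0// f_gt0//; lra.
have sg : smooth g by apply: smooth_affine; exact: smooth_flat_exp.
exists (f * (fun x => (f x + g x)^-1)); split.
- apply: smoothM; first exact: smooth_flat_exp.
  apply: (@smoothV _ _ (f + g)) => [x|]; first exact: lt0r_neq0 (fg0 x).
  by apply: smoothD => //; exact: smooth_flat_exp.
- by move=> y y0; rewrite /GRing.mul/= /f flat_exp0// mul0r.
- move=> y y1; rewrite /GRing.mul/=.
  rewrite [g y]flat_exp0 ?addr0; last lra.
  by rewrite divff// gt_eqF// f_gt0//; lra.
- move=> y; rewrite /GRing.mul/= ler_pdivrMr// mul1r lerDl flat_exp_ge0 andbT.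
  by rewrite mulr_ge0 ?flat_exp_ge0// invr_ge0 ltW.
Qed.

End smooth_line.

(** * The space L^2 *)

Section L2.
Context {R : realType}.
Local Notation mu := (@lebesgue_measure R).
Local Notation n2 := (Lp_norm 2%:E).
Implicit Types (f g h : R -> R) (v w : R -> R -> R).

Definition L2_inner f g : R := \int[mu]_x (f x * g x).

Lemma le1_2E : (1 <= 2%:E :> \bar R)%E.
Proof. by rewrite lee_fin ler1n. Qed.

Lemma in_Lp_measurable p f : in_Lp p f -> measurable_fun setT f.
Proof. by move=> /andP[/[!inE]/=]. Qed.

Lemma Lp_normE p f : in_Lp p f ->
  ((Lp_norm p f)%:E = 'N[mu]_p[EFin \o f])%E.
Proof.
move=> /andP[_ /[!inE]/= nf]; rewrite /Lp_norm fineK// ge0_fin_numE//.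
exact: Lnorm_ge0.
Qed.

Lemma Lp_norm_ge0 p f : 0 <= Lp_norm p f.
Proof. by rewrite fine_ge0// Lnorm_ge0. Qed.

Lemma in_LpD p f g : (1 <= p)%E -> in_Lp p f -> in_Lp p g -> in_Lp p (f \+ g).
Proof.
by move=> p1 Lf Lg; have [_] := Lfun_addr_closed mu p1; exact.
Qed.

Lemma in_LpN p f : in_Lp p f -> in_Lp p (\- f).
Proof. exact: Lfun_oppr_closed. Qed.

Lemma in_LpB p f g : (1 <= p)%E -> in_Lp p f -> in_Lp p g -> in_Lp p (f \- g).
Proof. by move=> p1 Lf Lg; apply: in_LpD => //; exact: in_LpN. Qed.

Lemma in_L2Z f (a : R) : in_Lp 2%:E f -> in_Lp 2%:E (fun x => a * f x).
Proof.
move=> Lf; rewrite /in_Lp (_ : (fun x => _) = a \o* f).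
  by apply: Lfun_scale => //; rewrite ler1n.
by apply/funext => x /=; rewrite mulrC.
Qed.

Lemma Lp_normN p f : Lp_norm p (\- f) = Lp_norm p f.
Proof.
by rewrite /Lp_norm -[in RHS]oppe_Lnorm.
Qed.

Lemma Lp_normD p f g : (1 <= p)%E -> in_Lp p f -> in_Lp p g ->
  Lp_norm p (f \+ g) <= Lp_norm p f + Lp_norm p g.
Proof.
move=> p1 Lf Lg; rewrite -lee_fin EFinD !Lp_normE//; last exact: in_LpD.
by apply: eminkowski => //;
  [exact: in_Lp_measurable Lf|exact: in_Lp_measurable Lg].
Qed.

Lemma L2_inner_integrable f g : in_Lp 2%:E f -> in_Lp 2%:E g ->
  mu.-integrable setT (EFin \o (fun x => f x * g x)).
Proof. by move=> Lf Lg; apply/Lfun1_integrable; exact: Lfun2_mul_Lfun1. Qed.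

Lemma L2_innerC f g : L2_inner f g = L2_inner g f.
Proof. by apply: eq_Rintegral => x _; rewrite mulrC. Qed.

Lemma L2_innerBl f g h : in_Lp 2%:E f -> in_Lp 2%:E g -> in_Lp 2%:E h ->
  L2_inner (f \- g) h = L2_inner f h - L2_inner g h.
Proof.
move=> Lf Lg Lh; rewrite /L2_inner -RintegralB//; try exact: L2_inner_integrable.
by apply: eq_Rintegral => x _; rewrite mulrBl.
Qed.

Lemma L2_innerBr f g h : in_Lp 2%:E f -> in_Lp 2%:E g -> in_Lp 2%:E h ->
  L2_inner h (f \- g) = L2_inner h f - L2_inner h g.
Proof. by move=> *; rewrite L2_innerC L2_innerBl// !(L2_innerC h). Qed.

Lemma L2_innerZl f g (a : R) : in_Lp 2%:E f -> in_Lp 2%:E g ->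
  L2_inner (fun x => a * f x) g = a * L2_inner f g.
Proof.
move=> Lf Lg; rewrite /L2_inner -RintegralZl//; last exact: L2_inner_integrable.
by apply: eq_Rintegral => x _; rewrite mulrA.
Qed.

Lemma L2_innerZr f g (a : R) : in_Lp 2%:E f -> in_Lp 2%:E g ->
  L2_inner g (fun x => a * f x) = a * L2_inner g f.
Proof. by move=> *; rewrite L2_innerC L2_innerZl// L2_innerC. Qed.

Lemma cauchy_schwarz f g : in_Lp 2%:E f -> in_Lp 2%:E g ->
  `|L2_inner f g| <= n2 f * n2 g.
Proof.
move=> Lf Lg; have ifg := L2_inner_integrable Lf Lg.
rewrite -lee_fin EFinM !Lp_normE// EFin_normr_Rintegral//.
apply: le_trans (le_abse_integral _ _ _) _ => //.
  by move/integrableP : ifg => [].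
have := @hoelder _ _ R mu f g 2 2 (in_Lp_measurable Lf) (in_Lp_measurable Lg).
rewrite Lnorm1; apply=> //; by rewrite [RHS]splitr !div1r.
Qed.

Lemma L2_norm_sqr f : in_Lp 2%:E f -> n2 f ^+ 2 = L2_inner f f.
Proof.
move=> Lf; rewrite -powR_mulrn ?Lp_norm_ge0//.
apply/EFin_inj; rewrite -poweR_EFin Lp_normE// powR_Lnorm//.
rewrite /L2_inner /Rintegral fineK.
  apply: eq_integral => x _; rewrite /= powR_mulrn//.
  by rewrite -normrX -expr2 ger0_norm// sqr_ge0.
exact: integrable_fin_num (L2_inner_integrable Lf Lf).
Qed.

Lemma in_L2_sqr f : measurable_fun setT f ->
  (\int[mu]_x (f x ^+ 2)%:E < +oo)%E -> in_Lp 2%:E f.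
Proof.
move=> mf sf; apply/andP; split; rewrite inE//=.
rewrite /finite_norm unlock /Lnorm; apply: poweR_lty.
apply: le_lt_trans sf; rewrite le_eqVlt; apply/orP; left; apply/eqP.
apply: eq_integral => x _ /=.
by rewrite powR_mulrn// -normrX ger0_norm// sqr_ge0.
Qed.

Lemma L2_supported f (K a b : R) : measurable_fun setT f -> a <= b ->
  (forall x, `|f x| <= K) -> (forall x, x < a \/ b < x -> f x = 0) ->
  in_Lp 2%:E f /\ n2 f <= K * Num.sqrt (b - a).
Proof.
move=> mf ab fK f0.
have K0 : 0 <= K := le_trans (normr_ge0 _) (fK 0).
have Hs : (\int[mu]_x (f x ^+ 2)%:E <= (K ^+ 2 * (b - a))%:E)%E.
  rewrite [leLHS](_ : _ = \int[mu]_(x in `[a, b]) (f x ^+ 2)%:E)%E; last first.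
    rewrite [RHS]integral_mkcond; apply: eq_integral => x _.
    rewrite patchE; case: ifPn => // /negP; rewrite inE/= in_itv/= => Hx.
    rewrite f0 ?expr0n//; case: (ltP x a) => xa; first by left.
    by right; rewrite ltNge; apply/negP => xb; apply: Hx; rewrite xa.
  apply: (@le_trans _ _ (\int[mu]_(x in `[a, b]) (K ^+ 2)%:E)%E).
    apply: ge0_le_integral => //.
    - by move=> x _; rewrite lee_fin sqr_ge0.
    - apply/measurable_EFinP; apply: measurable_funX.
      exact: measurable_funTS.
    - move=> x _; rewrite lee_fin -[leLHS]ger0_norm ?sqr_ge0//.
      by rewrite normrX ler_pXn2r ?nnegrE.
  rewrite integral_cst//= lebesgue_measure_itv/= lte_fin.
  case: ltP => [_|ba]; first by rewrite -EFinB -EFinM.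
  by rewrite mule0 lee_fin mulr_ge0 ?sqr_ge0// subr_ge0.
have Lf : in_Lp 2%:E f.
  by apply: in_L2_sqr => //; exact: le_lt_trans Hs (ltry _).
split=> //.
rewrite -(@ler_pXn2r _ 2) ?nnegrE ?mulr_ge0 ?Lp_norm_ge0//.
rewrite L2_norm_sqr// exprMn sqr_sqrtr ?subr_ge0//.
rewrite -lee_fin; apply: le_trans Hs.
rewrite /L2_inner /Rintegral fineK//.
by apply: integrable_fin_num => //; exact: L2_inner_integrable.
Qed.

End L2.

(** * Inner products of curves in L^2 *)

Section curves.
Context {R : realType}.
Local Notation n2 := (Lp_norm 2%:E).
Implicit Types (v w : R -> R -> R).

Lemma cvg_le_bound {T : Type} {F : set_system T} {FF : Filter F}
    (f b : T -> R) (l : R) :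
  (\forall x \near F, `|f x - l| <= b x) -> b x @[x --> F] --> 0 ->
  f x @[x --> F] --> l.
Proof.
move=> fb b0; apply/subr_cvg0; apply/norm_cvg0P.
apply: (squeeze_cvgr _ _ b0); last exact: cvg_cst.
by apply: filterS fb => x ->; rewrite normr_ge0.
Qed.

Lemma cvg_bound_eq0 {T : Type} {F : set_system T} {FF : Filter F}
    (b : T -> R) (l : R) : b x @[x --> F] --> l -> l = 0 -> b x @[x --> F] --> 0.
Proof. by move=> + <-. Qed.

Lemma dnbhs_shift (t : R) : h *: 1 + t @[h --> 0^'] --> t^'.
Proof.
move=> A /= [e /= e0 He]; exists e => //= h; rewrite /ball/= sub0r normrN => he h0.
apply: He; rewrite /ball/=.
  by rewrite -[h *: 1]/(h * 1) mulr1 opprD addrCA subrr addr0 normrN.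
by rewrite -[h *: 1]/(h * 1) mulr1 -subr_eq0 addrK.
Qed.

Lemma is_derive_slope (f : R -> R) (t l : R) :
  (s - t)^-1 * (f s - f t) @[s --> t^'] --> l -> is_derive t 1 f l.
Proof.
move=> Hl.
have H : h^-1 *: (f (h *: 1 + t) - f t) @[h --> 0^'] --> l.
  have := cvg_comp _ _ (@dnbhs_shift t) Hl.
  apply: cvg_trans; apply: near_eq_cvg; near=> h => /=.
  by rewrite addrK -[h *: 1]/(h * 1) mulr1.
by split; [apply/cvg_ex; exists l|exact: cvg_lim H].
Unshelve. all: by end_near. Qed.

Lemma near_within_ge0 (F : set_system R) {FF : Filter F} :
  \forall s \near within `[0, +oo[ F, 0 <= s.
Proof. by rewrite near_withinE; apply: nearW => s /=; rewrite in_itv/= andbT. Qed.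

Lemma L2_inner_continuous v w (t : R) : L2_curve_continuous v ->
  L2_curve_continuous w -> 0 <= t ->
  L2_inner (v s) (w s) @[s --> within `[0, +oo[ (nbhs t)] -->
    L2_inner (v t) (w t).
Proof.
move=> [Lv cv] [Lw cw] t0.
apply: (@cvg_le_bound _ _ _ _ (fun s => n2 (v s \- v t) * (n2 (w s \- w t) + n2 (w t))
  + n2 (v t) * n2 (w s \- w t))); last first.
  apply: cvg_bound_eq0.
    apply: cvgD; apply: cvgM; [exact: cv| |exact: cvg_cst|exact: cw].
    by apply: cvgD; [exact: cw|exact: cvg_cst].
  by rewrite mul0r mulr0 addr0.
near=> s; have s0 : 0 <= s by near: s; exact: near_within_ge0.
have Lvs := Lv _ s0; have Lvt := Lv _ t0.
have Lws := Lw _ s0; have Lwt := Lw _ t0.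
have Lvd : in_Lp 2%:E (v s \- v t) by apply: in_LpB => //; exact: le1_2E.
have Lwd : in_Lp 2%:E (w s \- w t) by apply: in_LpB => //; exact: le1_2E.
have -> : L2_inner (v s) (w s) - L2_inner (v t) (w t) =
    L2_inner (v s \- v t) (w s) + L2_inner (v t) (w s \- w t).
  by rewrite L2_innerBl// L2_innerBr//; ring.
apply: (le_trans (ler_normD _ _)); apply: lerD; last exact: cauchy_schwarz.
apply: (le_trans (cauchy_schwarz _ _)) => //.
rewrite ler_wpM2l ?Lp_norm_ge0//.
(* The norm of [w s] varies with [s]; it is controlled through its distance to the fixed [w t],
   which tends to 0. *)
rewrite [leLHS](_ : _ = n2 ((w s \- w t) \+ w t)).
  by apply: Lp_normD => //; exact: le1_2E.
by congr Lp_norm; apply/funext => x /=; rewrite subrK.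
Unshelve. all: by end_near. Qed.

Lemma L2_inner_derivative v v' w w' (t : R) :
  L2_curve_continuous v -> L2_curve_continuous v' -> L2_curve_derivative v v' ->
  L2_curve_continuous w -> L2_curve_continuous w' -> L2_curve_derivative w w' ->
  0 < t -> is_derive t 1 (fun s => L2_inner (v s) (w s))
    (L2_inner (v' t) (w t) + L2_inner (v t) (w' t)).
Proof.
move=> [Lv cv] [Lv' _] dv [Lw cw] [Lw' _] dw t0.
apply: is_derive_slope.
have inW (F : set_system R) : Filter F -> F --> nbhs t ->
    (forall f : R -> R, f s @[s --> within `[0, +oo[ F] --> 0 -> f s @[s --> F] --> 0).
  move=> FF Ft f Hf A /Hf /=; rewrite /nbhs/= /within/= => H.
  have : F [set s | 0 < s] by apply: Ft; exact: lt_nbhsr.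
  by apply: filterS2 H => s + s0; apply; rewrite in_itv/= andbT ltW.
have cw0 : n2 (w s \- w t) @[s --> t^'] --> 0.
  apply: inW; first exact: cvg_within.
  apply: cvg_trans (@cw t (ltW t0)) => A /=; rewrite /nbhs/= /within/=.
  by apply: filterS => s + st; exact.
have dv0 := inW _ _ (cvg_within _) _ (@dv t (ltW t0)).
have dw0 := inW _ _ (cvg_within _) _ (@dw t (ltW t0)).
apply: (@cvg_le_bound _ _ _ _ (fun s =>
  n2 (fun x => (s - t)^-1 * (v s x - v t x) - v' t x) * (n2 (w s \- w t) + n2 (w t))
  + n2 (v' t) * n2 (w s \- w t)
  + n2 (v t) * n2 (fun x => (s - t)^-1 * (w s x - w t x) - w' t x))); last first.
  apply: cvg_bound_eq0.
    apply: cvgD; [apply: cvgD|]; apply: cvgM;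
      [exact: dv0| |exact: cvg_cst|exact: cw0|exact: cvg_cst|exact: dw0].
    by apply: cvgD; [exact: cw0|exact: cvg_cst].
  by rewrite mul0r !mulr0 !addr0.
near=> s.
have s0 : 0 <= s by rewrite ltW//; near: s; apply: cvg_within; exact: lt_nbhsr.
have Lvs := Lv _ s0; have Lvt := Lv _ (ltW t0); have Lv't := Lv' _ (ltW t0).
have Lws := Lw _ s0; have Lwt := Lw _ (ltW t0); have Lw't := Lw' _ (ltW t0).
have Lvd : in_Lp 2%:E (v s \- v t) by apply: in_LpB => //; exact: le1_2E.
have Lwd : in_Lp 2%:E (w s \- w t) by apply: in_LpB => //; exact: le1_2E.
have Lvq := in_L2Z (s - t)^-1 Lvd; have Lwq := in_L2Z (s - t)^-1 Lwd.
have Lve : in_Lp 2%:E ((fun x => (s - t)^-1 * (v s x - v t x)) \- v' t).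
  by apply: in_LpB => //; exact: le1_2E.
have Lwe : in_Lp 2%:E ((fun x => (s - t)^-1 * (w s x - w t x)) \- w' t).
  by apply: in_LpB => //; exact: le1_2E.
(* Discrete Leibniz rule: the quotient of [v] is paired with [w s], that of [w] with [v t]. The
   middle term replaces [w s] by [w t] in the limit. *)
have -> : (s - t)^-1 * (L2_inner (v s) (w s) - L2_inner (v t) (w t)) -
   (L2_inner (v' t) (w t) + L2_inner (v t) (w' t)) =
   L2_inner ((fun x => (s - t)^-1 * (v s x - v t x)) \- v' t) (w s) +
   L2_inner (v' t) (w s \- w t) +
   L2_inner (v t) ((fun x => (s - t)^-1 * (w s x - w t x)) \- w' t).
  rewrite (L2_innerBl (f := fun x => (s - t)^-1 * (v s x - v t x)))//.
  rewrite (L2_innerBr (f := fun x => (s - t)^-1 * (w s x - w t x)))//.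
  rewrite (L2_innerZl (f := v s \- v t))// (L2_innerZr (f := w s \- w t))//.
  by rewrite L2_innerBl// !L2_innerBr//; ring.
apply: (le_trans (ler_normD _ _)); apply: lerD; last exact: cauchy_schwarz.
apply: (le_trans (ler_normD _ _)); apply: lerD; last exact: cauchy_schwarz.
apply: (le_trans (cauchy_schwarz _ _)) => //.
rewrite ler_wpM2l ?Lp_norm_ge0//.
rewrite [leLHS](_ : _ = n2 ((w s \- w t) \+ w t)).
  by apply: Lp_normD => //; exact: le1_2E.
by congr Lp_norm; apply/funext => x /=; rewrite subrK.
Unshelve. all: by end_near. Qed.
End curves.

(** * Waves generated by a test function *)

Section mean_value.
Context {R : realType}.
Implicit Types (f : R -> R).

Lemma differentiable_continuous_line f : (forall x, differentiable f x) ->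
  continuous f.
Proof. by move=> df x; exact/differentiable_continuous. Qed.

Lemma mean_value f (x y : R) : (forall z, differentiable f z) ->
  exists2 c, `|c - x| <= `|y - x| & f y - f x = 'D_1 f c * (y - x).
Proof.
move=> df.
have dfz (z : R) : is_derive z 1 f ('D_1 f z).
  by apply: derivableP; exact/derivable1_diffP.
have cf A : {within A, continuous f}.
  by apply: continuous_subspaceT; exact: differentiable_continuous_line.
have [xy|yx] := leP x y.
  have [c + ->] := MVT_segment xy (fun z _ => dfz z) (cf _).
  rewrite in_itv/= => /andP[xc cy]; exists c => //.
  by rewrite !ger0_norm ?subr_ge0// lerB.
have [c + H] := MVT_segment (ltW yx) (fun z _ => dfz z) (cf _).
rewrite in_itv/= => /andP[yc cx]; exists c.
  by rewrite !ler0_norm ?subr_le0 ?(ltW yx)// lerN2 lerB.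
by rewrite -opprB H -mulrN opprB.
Qed.

Lemma lipschitz_derive f (K x y : R) : (forall z, differentiable f z) ->
  (forall z, `|'D_1 f z| <= K) -> `|f y - f x| <= K * `|y - x|.
Proof.
move=> df fK; have [c _ ->] := mean_value x y df.
by rewrite normrM ler_wpM2r.
Qed.

(** The mean value theorem is applied to [f] and then to its derivative. This gives [K] instead of
    K/2, which is enough for a derivative in L^2. *)
Lemma taylor1 f (K x y : R) : (forall z, differentiable f z) ->
  (forall z, differentiable ('D_1 f) z) ->
  (forall z, `|'D_1 ('D_1 f) z| <= K) ->
  `|f y - f x - 'D_1 f x * (y - x)| <= K * `|y - x| ^+ 2.
Proof.
move=> df ddf fK; have [c cx ->] := mean_value x y df.
rewrite -mulrBl normrM expr2 mulrA ler_wpM2r//.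
apply: (le_trans (lipschitz_derive x c ddf fK)).
by rewrite ler_wpM2l// (le_trans _ (fK 0)).
Qed.

Lemma supported_bounded f (a b : R) : continuous f ->
  (forall x, x < a \/ b < x -> f x = 0) -> exists K, forall x, `|f x| <= K.
Proof.
move=> cf f0; have [ab|ba] := leP a b.
  have cn : {within `[a, b], continuous (fun x => `|f x|)}.
    by apply: continuous_subspaceT => x; apply: cvg_norm; exact: cf.
  have [c _ Hc] := EVT_max ab cn.
  exists `|f c| => x; have [xab|] := boolP (x \in `[a, b]%R); first exact: Hc.
  rewrite in_itv/= negb_and -!ltNge => /orP.
  by move=> xab; rewrite f0 ?normr0.
exists 0 => x; rewrite f0 ?normr0//.
by have [|] := ltP x a; [left|right; exact: lt_le_trans ba _].
Qed.

Lemma derive_locally_cst f (c x : R) :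
  (\forall y \near x, f y = c) -> 'D_1 f x = 0.
Proof.
move=> fc; rewrite (@near_eq_derive _ _ _ _ (cst c))//.
exact: derive_cst.
Qed.

End mean_value.

(** * Backward waves as curves in L^2 *)

Section traveling_waves.
Context {R : realType}.
Local Notation n2 := (Lp_norm 2%:E).

(** These are the primitives, vanishing near -oo, of the test functions on the line; [c] is the
    integral of the test function and need not be 0. *)
Definition primitive_test (F : R -> R) (a b c : R) : Prop :=
  [/\ smooth F, a <= b, forall y, y <= a -> F y = 0 & forall y, b <= y -> F y = c].

Definition wave (F : R -> R) (T t x : R) : R :=
  (F (x + (T - t)) - F (x - (T - t))) / 2.

Definition wave_t (F : R -> R) (T t x : R) : R :=
  - ('D_1 F (x + (T - t)) + 'D_1 F (x - (T - t))) / 2.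

Section estimates.
Variables (F : R -> R) (a b c T : R).
Hypothesis HF : primitive_test F a b c.

Let sF : smooth F. Proof. by case: HF. Qed.

Lemma primitive_test_derive0 x : x < a \/ b < x -> 'D_1 F x = 0.
Proof.
case: HF => _ ab Fa Fb [xa|bx].
  apply: (@derive_locally_cst _ _ 0); near=> y; apply: Fa; apply/ltW.
  by near: y; exact: lt_nbhsl.
apply: (@derive_locally_cst _ _ c); near=> y; apply: Fb; apply/ltW.
by near: y; exact: lt_nbhsr.
Unshelve. all: by end_near. Qed.

Lemma primitive_test_derive20 x : x < a \/ b < x -> 'D_1 ('D_1 F) x = 0.
Proof.
move=> [xa|bx]; apply: (@derive_locally_cst _ _ 0); near=> y;
  apply: primitive_test_derive0; [left|right]; near: y;
  [exact: lt_nbhsl|exact: lt_nbhsr].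
Unshelve. all: by end_near. Qed.

Let dF x : differentiable F x.
Proof. exact: smooth_differentiable. Qed.

Let ddF x : differentiable ('D_1 F) x.
Proof. by apply: smooth_differentiable; exact: smooth_derive. Qed.

Let cF := differentiable_continuous_line dF.
Let cdF := differentiable_continuous_line ddF.

Lemma primitive_test_bounds : exists K, forall x,
  [/\ `|F x| <= K, `|'D_1 F x| <= K & `|'D_1 ('D_1 F) x| <= K].
Proof.
have [K1 HK1] := supported_bounded cdF primitive_test_derive0.
have [K2 HK2] : exists K, forall x, `|'D_1 ('D_1 F) x| <= K.
  apply: (supported_bounded _ primitive_test_derive20).
  apply: differentiable_continuous_line => x.
  by apply: smooth_differentiable; do 2 apply: smooth_derive.
have [K0 HK0] : exists K, forall x, `|F x| <= K.
  case: HF => _ ab Fa Fb.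
  have cn : {within `[a, b], continuous (fun x => `|F x|)}.
    by apply: continuous_subspaceT => x; apply: cvg_norm; exact: cF.
  have [d _ Hd] := EVT_max ab cn.
  exists `|F d| => x; have [xa|ax] := leP x a; first by rewrite Fa ?normr0.
  have [xb|bx] := leP x b; first by apply: Hd; rewrite in_itv/= xb ltW.
  by rewrite (Fb _ (ltW bx)) -(Fb b)//; apply: Hd; rewrite in_itv/= ab lexx.
have K0p := le_trans (normr_ge0 _) (HK0 0).
have K1p := le_trans (normr_ge0 _) (HK1 0).
have K2p := le_trans (normr_ge0 _) (HK2 0).
exists (K0 + K1 + K2) => x; split.
- by apply: (le_trans (HK0 x)); rewrite -addrA lerDl addr_ge0.
- by apply: (le_trans (HK1 x)); rewrite addrAC lerDr addr_ge0.
- by apply: (le_trans (HK2 x)); rewrite lerDr addr_ge0.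
Qed.

Definition wave_radius (t : R) := `|a| + `|b| + `|T| + `|t|.

(** Beyond the radius both characteristics pass on the same side of [a, b], where [F] is constant.
    This is why the wave has compact support in x although [F] may equal a nonzero [c] up to +oo. *)
Lemma wave_radius_args (t x : R) : x < - wave_radius t \/ wave_radius t < x ->
  (x + (T - t) < a /\ x - (T - t) < a) \/ (b < x + (T - t) /\ b < x - (T - t)).
Proof.
rewrite /wave_radius.
have := ler_norm a; have := ler_norm (- a); rewrite normrN.
have := ler_norm b; have := ler_norm (- b); rewrite normrN.
have := ler_norm T; have := ler_norm (- T); rewrite normrN.
have := ler_norm t; have := ler_norm (- t); rewrite normrN.
by move=> ? ? ? ? ? ? ? ? [?|?]; [left|right]; split; lra.
Qed.

Lemma wave_radius_ge0 t : 0 <= wave_radius t.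
Proof. by rewrite !addr_ge0. Qed.

Lemma wave_supported t x : x < - wave_radius t \/ wave_radius t < x ->
  wave F T t x = 0.
Proof.
case: HF => _ _ Fa Fb; rewrite /wave => /wave_radius_args[[? ?]|[? ?]].
  by rewrite !Fa ?ltW// subrr mul0r.
by rewrite !Fb ?ltW// subrr mul0r.
Qed.

Lemma wave_t_supported t x : x < - wave_radius t \/ wave_radius t < x ->
  wave_t F T t x = 0.
Proof.
by rewrite /wave_t => /wave_radius_args[[? ?]|[? ?]];
  rewrite !primitive_test_derive0 ?addr0 ?oppr0 ?mul0r//; tauto.
Qed.

Lemma continuous_wave t : continuous (wave F T t).
Proof.
move=> x; apply: cvgM; last exact: cvg_cst.
have cs (k : R) : {for x, continuous (fun y => F (y + k))}.
  apply: (@continuous_comp _ _ _ (fun y => y + k) F); last exact: cF.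
  by apply: cvgD; [exact: cvg_id|exact: cvg_cst].
by apply: cvgB; exact: cs.
Qed.

Lemma continuous_wave_t t : continuous (wave_t F T t).
Proof.
move=> x; apply: cvgM; last exact: cvg_cst.
have cs (k : R) : {for x, continuous (fun y => 'D_1 F (y + k))}.
  apply: (@continuous_comp _ _ _ (fun y => y + k) ('D_1 F)); last exact: cdF.
  by apply: cvgD; [exact: cvg_id|exact: cvg_cst].
by apply: cvgN; apply: cvgD; exact: cs.
Qed.

Lemma wave_radius_le (s t x : R) : `|s - t| <= 1 ->
  x < - (wave_radius t + 1) \/ wave_radius t + 1 < x ->
  x < - wave_radius s \/ wave_radius s < x.
Proof.
have : `|s| <= `|s - t| + `|t| by rewrite (le_trans _ (ler_normD _ _))// subrK.
by rewrite /wave_radius => ? ? [?|?]; [left|right]; lra.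
Qed.

Lemma L2_supported_wave (f : R -> R) (K t : R) : continuous f ->
  (forall x, `|f x| <= K) ->
  (forall x, x < - (wave_radius t + 1) \/ wave_radius t + 1 < x -> f x = 0) ->
  in_Lp 2%:E f /\ n2 f <= K * Num.sqrt (2 * (wave_radius t + 1)).
Proof.
move=> cf fK f0; have r0 := wave_radius_ge0 t.
rewrite (_ : 2 * _ = wave_radius t + 1 - (- (wave_radius t + 1))); last by ring.
by apply: L2_supported => //; [exact: continuous_measurable_fun|lra].
Qed.

Lemma in_L2_wave t : in_Lp 2%:E (wave F T t).
Proof.
have [K HK] := primitive_test_bounds.
apply: (@proj1 _ _ (@L2_supported_wave _ K t (@continuous_wave t) _ _)).
  move=> x; rewrite /wave normrM (@ger0_norm _ 2^-1)// ler_pdivrMr//.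
  apply: (le_trans (ler_normB _ _)).
  have [H1 _ _] := HK (x + (T - t)); have [H2 _ _] := HK (x - (T - t)); lra.
by move=> x Hx; apply: wave_supported; apply: (@wave_radius_le t t) => //;
  rewrite subrr normr0.
Qed.

Lemma in_L2_wave_t t : in_Lp 2%:E (wave_t F T t).
Proof.
have [K HK] := primitive_test_bounds.
apply: (@proj1 _ _ (@L2_supported_wave _ K t (@continuous_wave_t t) _ _)).
  move=> x; rewrite /wave_t normrM normrN (@ger0_norm _ 2^-1)// ler_pdivrMr//.
  apply: (le_trans (ler_normD _ _)).
  have [_ H1 _] := HK (x + (T - t)); have [_ H2 _] := HK (x - (T - t)); lra.
by move=> x Hx; apply: wave_t_supported; apply: (@wave_radius_le t t) => //;
  rewrite subrr normr0.
Qed.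

(* Pointwise estimates transfer to L^2 because, for s within 1 of t, all the
   functions involved vanish outside a fixed interval. *)
Lemma L2_cvg0_wave (q : R -> R -> R) (K t : R) (A : set R) (F0 : set_system R) :
  Filter F0 -> F0 --> nbhs t ->
  (forall s, continuous (q s)) ->
  (forall s x, A s -> `|q s x| <= K * `|s - t|) ->
  (forall s x, `|s - t| <= 1 ->
    x < - (wave_radius t + 1) \/ wave_radius t + 1 < x -> q s x = 0) ->
  n2 (q s) @[s --> within A F0] --> 0.
Proof.
move=> FF Ft cq qK q0.
apply: (@cvg_le_bound _ _ _ _ _ (fun s =>
  K * `|s - t| * Num.sqrt (2 * (wave_radius t + 1)))); last first.
  suff H : K * `|s - t| * Num.sqrt (2 * (wave_radius t + 1)) @[s --> t] --> 0.
    by move=> U /H /Ft HU; exact: cvg_within HU.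
  apply: cvg_bound_eq0.
    apply: cvgM; last exact: cvg_cst.
    apply: cvgM; first exact: cvg_cst.
    apply: cvg_norm; apply: cvgB; [exact: cvg_id|exact: cvg_cst].
  by rewrite subrr normr0 mulr0 mul0r.
have near1 : F0 [set s | `|s - t| <= 1].
  apply: Ft; exists 1 => //= s; rewrite /ball/= distrC; exact: ltW.
rewrite near_withinE; apply: filterS near1 => s s1 As.
rewrite subr0 ger0_norm ?Lp_norm_ge0//.
apply: (@proj2 _ _ (@L2_supported_wave _ _ t (cq s) _ _)).
  by move=> x; exact: qK.
by move=> x; exact: q0.
Qed.

Lemma L2_curve_continuous_wave : L2_curve_continuous (wave F T).
Proof.
split=> [t _|t t0]; first exact: in_L2_wave.
have [K HK] := primitive_test_bounds.
apply: (@L2_cvg0_wave (fun s => wave F T s \- wave F T t) K) => //.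
- by move=> s x; apply: cvgB; exact: continuous_wave.
- move=> s x _; rewrite /wave/= -mulrBl normrM (@ger0_norm _ 2^-1)//.
  rewrite ler_pdivrMr//.
  have H1 := lipschitz_derive (x + (T - t)) (x + (T - s)) dF (fun z =>
    let: And3 _ H _ := HK z in H).
  have H2 := lipschitz_derive (x - (T - t)) (x - (T - s)) dF (fun z =>
    let: And3 _ H _ := HK z in H).
  rewrite (_ : x + (T - s) - (x + (T - t)) = - (s - t)) in H1; last by ring.
  rewrite (_ : x - (T - s) - (x - (T - t)) = s - t) in H2; last by ring.
  rewrite normrN in H1.
  rewrite (_ : _ - _ = (F (x + (T - s)) - F (x + (T - t))) -
     (F (x - (T - s)) - F (x - (T - t)))); last by ring.
  apply: (le_trans (ler_normB _ _)); lra.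
- move=> s x s1 Hx /=; rewrite !wave_supported ?subrr//.
    by apply: (@wave_radius_le t t) => //; rewrite subrr normr0.
  exact: wave_radius_le Hx.
Qed.

Lemma L2_curve_continuous_wave_t : L2_curve_continuous (wave_t F T).
Proof.
split=> [t _|t t0]; first exact: in_L2_wave_t.
have [K HK] := primitive_test_bounds.
apply: (@L2_cvg0_wave (fun s => wave_t F T s \- wave_t F T t) K) => //.
- by move=> s x; apply: cvgB; exact: continuous_wave_t.
- move=> s x _; rewrite /wave_t/= -mulrBl normrM (@ger0_norm _ 2^-1)//.
  rewrite ler_pdivrMr//.
  have H1 := lipschitz_derive (x + (T - t)) (x + (T - s)) ddF (fun z =>
    let: And3 _ _ H := HK z in H).
  have H2 := lipschitz_derive (x - (T - t)) (x - (T - s)) ddF (fun z =>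
    let: And3 _ _ H := HK z in H).
  rewrite (_ : x + (T - s) - (x + (T - t)) = - (s - t)) in H1; last by ring.
  rewrite (_ : x - (T - s) - (x - (T - t)) = s - t) in H2; last by ring.
  rewrite normrN in H1.
  rewrite (_ : _ - _ = - ('D_1 F (x + (T - s)) - 'D_1 F (x + (T - t))) -
     ('D_1 F (x - (T - s)) - 'D_1 F (x - (T - t)))); last by ring.
  apply: (le_trans (ler_normB _ _)); rewrite normrN; lra.
- move=> s x s1 Hx /=; rewrite !wave_t_supported ?subrr//.
    by apply: (@wave_radius_le t t) => //; rewrite subrr normr0.
  exact: wave_radius_le Hx.
Qed.

Lemma L2_curve_derivative_wave : L2_curve_derivative (wave F T) (wave_t F T).
Proof.
move=> t t0; have [K HK] := primitive_test_bounds.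
(* Puts s != t into the set [A] of [L2_cvg0_wave]: at s = t the inverse is 0 by convention, and the
   bound K |s - t| could fail there. *)
have -> : within `[0, +oo[ t^' = within (`[0, +oo[ `&` [set s | s != t]) (nbhs t).
  apply/funext => U; apply/propext; split.
    move=> HU; have {}HU : nbhs t [set s | s != t -> s \in `[0, +oo[%R -> U s] := HU.
    by apply: (filterS _ HU) => s H [? ?]; exact: H.
  move=> HU; have {}HU : nbhs t [set s | s \in `[0, +oo[%R /\ s != t -> U s] := HU.
  suff : nbhs t [set s | s != t -> s \in `[0, +oo[%R -> U s] by [].
  by apply: (filterS _ HU) => s H ? ?; exact: H.
apply: (@L2_cvg0_wave (fun s x =>
  (s - t)^-1 * (wave F T s x - wave F T t x) - wave_t F T t x) K) => //.
- move=> s x; apply: cvgB; last exact: continuous_wave_t.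
  apply: cvgM; first exact: cvg_cst.
  by apply: cvgB; exact: continuous_wave.
- move=> s x [_ /= st]; have st0 : s - t != 0 by rewrite subr_eq0.
  have H1 := taylor1 (x + (T - t)) (x + (T - s)) dF ddF (fun z => let: And3 _ _ H :=
    HK z in H).
  have H2 := taylor1 (x - (T - t)) (x - (T - s)) dF ddF (fun z => let: And3 _ _ H :=
    HK z in H).
  rewrite (_ : x + (T - s) - (x + (T - t)) = - (s - t)) in H1; last by ring.
  rewrite (_ : x - (T - s) - (x - (T - t)) = s - t) in H2; last by ring.
  rewrite normrN in H1.
  rewrite -(@ler_pM2l _ `|s - t|) ?normr_gt0// -normrM.
  rewrite [leRHS](_ : _ = K * `|s - t| ^+ 2); last by ring.
  (* Multiplied by s - t, the error of the difference quotient is half the difference of the Taylor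
     remainders of [F] along the two characteristics. *)
  rewrite (_ : _ * _ = ((F (x + (T - s)) - F (x + (T - t)) - 'D_1 F (x + (T - t)) * -
    (s - t))
     - (F (x - (T - s)) - F (x - (T - t)) - 'D_1 F (x - (T - t)) * (s - t))) / 2).
    rewrite normrM (@ger0_norm _ 2^-1)// ler_pdivrMr//.
    apply: (le_trans (ler_normB _ _)); lra.
  by rewrite /wave /wave_t; field.
- move=> s x s1 Hx /=; rewrite !wave_supported ?wave_t_supported ?subrr ?mulr0 ?subrr//.
  + by apply: (@wave_radius_le t t) => //; rewrite subrr normr0.
  + by apply: (@wave_radius_le t t) => //; rewrite subrr normr0.
  + exact: wave_radius_le Hx.
Qed.

End estimates.
End traveling_waves.

(** * The weak formulation *)

Section product_test_functions.
Context {R : realType}.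
Variable T : R.
Implicit Types (theta p q : R -> R).

Let lp (z : R * R) : R := z.2 + (T - z.1).
Let lm (z : R * R) : R := z.2 - (T - z.1).

Lemma differentiable_fst_line (z : R * R) : differentiable (fst : R * R -> R) z.
Proof. by apply: linear_differentiable => ?; exact: cvg_fst. Qed.

Lemma differentiable_snd_line (z : R * R) : differentiable (snd : R * R -> R) z.
Proof. by apply: linear_differentiable => ?; exact: cvg_snd. Qed.

Lemma derive_fst (z v : R * R) : 'D_v (fst : R * R -> R) z = v.1.
Proof.
rewrite deriveE; last exact: differentiable_fst_line.
by rewrite diff_lin// => ?; exact: cvg_fst.
Qed.

Lemma derive_snd (z v : R * R) : 'D_v (snd : R * R -> R) z = v.2.
Proof.
rewrite deriveE; last exact: differentiable_snd_line.
by rewrite diff_lin// => ?; exact: cvg_snd.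
Qed.

Let lpE : lp = (snd : R * R -> R) + (cst T - (fst : R * R -> R)).
Proof. by []. Qed.

Let lmE : lm = (snd : R * R -> R) - (cst T - (fst : R * R -> R)).
Proof. by []. Qed.

Let dlp z : differentiable lp z.
Proof.
rewrite lpE; apply: differentiableD; first exact: differentiable_snd_line.
by apply: differentiableB => //; exact: differentiable_fst_line.
Qed.

Let dlm z : differentiable lm z.
Proof.
rewrite lmE; apply: differentiableB; first exact: differentiable_snd_line.
by apply: differentiableB => //; exact: differentiable_fst_line.
Qed.

Let derive_lp (z v : R * R) : 'D_v lp z = v.2 - v.1.
Proof.
rewrite lpE deriveD; [|apply: diff_derivable..].
- rewrite deriveB; [|apply: diff_derivable..] => //;
  last exact: differentiable_fst_line.
  by rewrite derive_cst derive_fst derive_snd sub0r.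
- exact: differentiable_snd_line.
- by apply: differentiableB => //; exact: differentiable_fst_line.
Qed.

Let derive_lm (z v : R * R) : 'D_v lm z = v.2 + v.1.
Proof.
rewrite lmE deriveB; [|apply: diff_derivable..].
- rewrite deriveB; [|apply: diff_derivable..] => //;
  last exact: differentiable_fst_line.
  by rewrite derive_cst derive_fst derive_snd sub0r opprK.
- exact: differentiable_snd_line.
- by apply: differentiableB => //; exact: differentiable_fst_line.
Qed.

(** A time factor times a sum of two travelling profiles. A directional derivative of such a
    function is a sum of two functions of the same kind, so one formula, used twice, gives all
    second derivatives. *)
Definition separated theta p q (z : R * R) : R :=
  theta z.1 * (p (z.2 + (T - z.1)) + q (z.2 - (T - z.1))).

Let separatedE theta p q :
  separated theta p q = (theta \o fst) * ((p \o lp) + (q \o lm)).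
Proof. by []. Qed.

Lemma smooth_separated theta p q : smooth theta -> smooth p -> smooth q ->
  smooth (separated theta p q).
Proof.
move=> st sp sq; rewrite separatedE; apply: smoothM.
  apply: (smooth_comp (c := fst)) => // [z|z v]; last exact: derive_fst.
  exact: differentiable_fst_line.
apply: smoothD; first by apply: smooth_comp sp => // z v; exact: derive_lp.
by apply: smooth_comp sq => // z v; exact: derive_lm.
Qed.

Lemma derive_separated theta p q (v : R * R) :
  smooth theta -> smooth p -> smooth q ->
  'D_v (separated theta p q) =
  separated (fun t => v.1 * 'D_1 theta t) p q +
  separated theta (fun y => (v.2 - v.1) * 'D_1 p y)
                  (fun y => (v.2 + v.1) * 'D_1 q y).
Proof.
move=> /smooth_differentiable dt /smooth_differentiable dp
  /smooth_differentiable dq.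
apply/funext => z; rewrite separatedE.
have df := differentiable_fst_line.
have d1 : differentiable (theta \o fst) z by exact: differentiable_comp.
have d2 : differentiable (p \o lp) z by exact: differentiable_comp.
have d3 : differentiable (q \o lm) z by exact: differentiable_comp.

have d23 : differentiable ((p \o lp) + (q \o lm)) z by exact: differentiableD.

have e1 : derivable (theta \o fst) z v by exact: diff_derivable.
have e2 : derivable (p \o lp) z v by exact: diff_derivable.
have e3 : derivable (q \o lm) z v by exact: diff_derivable.
have e23 : derivable ((p \o lp) + (q \o lm)) z v by exact: diff_derivable.
rewrite (deriveM e1 e23).
rewrite (deriveD e2 e3).
rewrite (derive_comp_line v (dt _) (df z)).
rewrite (derive_comp_line v (dp _) (dlp z)).
rewrite (derive_comp_line v (dq _) (dlm z)).
rewrite derive_lp derive_lm derive_fst.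
change (theta z.1 *
    ((v.2 - v.1) * 'D_1 p (lp z) + (v.2 + v.1) * 'D_1 q (lm z)) +
    (p (lp z) + q (lm z)) * (v.1 * 'D_1 theta z.1) =
  v.1 * 'D_1 theta z.1 * (p (lp z) + q (lm z)) +
  theta z.1 * ((v.2 - v.1) * 'D_1 p (lp z) + (v.2 + v.1) * 'D_1 q (lm z))).
by rewrite addrC [X in X + _]mulrC.
Qed.

End product_test_functions.

Section wave_test_function.
Context {R : realType}.
Implicit Types (theta p q F : R -> R).

Lemma smoothZ (V : normedModType R) (k : R) (f : V -> R) : smooth f ->
  smooth (fun x => k * f x).
Proof. by move=> sf; apply: (smoothM (smooth_cst k) sf). Qed.

Lemma derive1Z (k : R) (f : R -> R) : smooth f ->
  'D_1 (fun x => k * f x) = (fun x => k * 'D_1 f x).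
Proof.
move=> /smooth_differentiable df; apply/funext => t; rewrite -deriveMl//.
exact/derivable1_diffP.
Qed.

Lemma derive_separated_t T theta p q : smooth theta -> smooth p -> smooth q ->
  'D_((1, 0) : R * R) (separated T theta p q) =
  separated T ('D_1 theta) p q +
  separated T theta (fun y => -1 * 'D_1 p y) ('D_1 q).
Proof.
move=> st sp sq; rewrite derive_separated//=.
by congr (separated _ _ _ _ + separated _ _ _ _); apply/funext => y;
  rewrite ?sub0r ?add0r ?mul1r.
Qed.

Lemma derive_separated_x T theta p q : smooth theta -> smooth p -> smooth q ->
  'D_((0, 1) : R * R) (separated T theta p q) =
  separated T theta ('D_1 p) ('D_1 q).
Proof.
move=> st sp sq; rewrite derive_separated//=; apply/funext => z.
change (separated T (fun t => 0 * 'D_1 theta t) p q z +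
  separated T theta (fun y => (1 - 0) * 'D_1 p y)
                    (fun y => (1 + 0) * 'D_1 q y) z =
  separated T theta ('D_1 p) ('D_1 q) z).
by rewrite /separated subr0 addr0 !mul1r !mul0r add0r.
Qed.

Lemma wave_separated theta F T : (fun z => theta z.1 * wave F T z.1 z.2) =
  separated T theta (fun y => 2^-1 * F y) (fun y => - 2^-1 * F y).
Proof. by apply/funext => z; rewrite /wave /separated; ring. Qed.

(** By the Leibniz rule the remaining term is theta (W_tt - W_xx), and it vanishes because the wave
    is a superposition of travelling profiles. *)
Lemma wave_operator_test theta F T (t x : R) : smooth theta -> smooth F ->
  let phi := fun z => theta z.1 * wave F T z.1 z.2 in
  'D_((1, 0) : R * R) ('D_((1, 0) : R * R) phi) (t, x)
    - 'D_((0, 1) : R * R) ('D_((0, 1) : R * R) phi) (t, x) =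
  'D_1 ('D_1 theta) t * wave F T t x + 2 * 'D_1 theta t * wave_t F T t x.
Proof.
move=> st sF phi; rewrite /phi wave_separated.
set p := fun y => 2^-1 * F y; set q := fun y => - 2^-1 * F y.
have sp : smooth p by exact: smoothZ.
have sq : smooth q by exact: smoothZ.
have sd (f : R -> R) : smooth f -> smooth ('D_1 f) by exact: smooth_derive.
have st' := sd _ st; have sp' := sd _ sp; have sq' := sd _ sq.
have sNp' : smooth (fun y => -1 * 'D_1 p y) by exact: smoothZ.
have dif f g h : smooth f -> smooth g -> smooth h ->
    derivable (separated T f g h) (t, x) ((1, 0) : R * R).
  move=> sf sg sh; apply: diff_derivable; apply: smooth_differentiable.
  exact: smooth_separated.
(* [P] and [Q] stand for the values of [F] on the two characteristics, [A'] and [B'] for those of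
   its derivative, [A] and [B] for the second derivatives of [p] and [q], whose contributions
   cancel. *)
have alg (th th1 th2 A B A' B' P Q : R) :
  th2 * (2^-1 * P + - 2^-1 * Q) + th1 * (-1 * (2^-1 * A') + - 2^-1 * B') +
  (th1 * (-1 * (2^-1 * A') + - 2^-1 * B') + th * (-1 * (-1 * A) + B)) -
  th * (A + B) = th2 * ((P - Q) / 2) + 2 * th1 * (- (A' + B') / 2) by field.
have eqD (f g : R * R -> R) (v z : R * R) : f = g -> 'D_v f z = 'D_v g z.
  by move=> ->.
have E1 := derive_separated_t T st sp sq.
have E2 := derive_separated_t T st' sp sq.
have E3 := derive_separated_t T st sNp' sq'.
have F1 := derive_separated_x T st sp sq.
have F2 := derive_separated_x T st sp' sq'.
rewrite (eqD _ _ _ _ E1) (deriveD (dif _ _ _ st' sp sq) (dif _ _ _ st sNp' sq')).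
have {}E2 := congr1 (@^~ (t, x)) E2; have {}E3 := congr1 (@^~ (t, x)) E3.
have {}F2 := congr1 (@^~ (t, x)) F2; rewrite /= in E2 E3 F2.
rewrite (eqD _ _ _ _ F1) E2 E3 F2.
have dpE z : 'D_1 p z = 2^-1 * 'D_1 F z := congr1 (@^~ z) (derive1Z _ sF).
have dqE z : 'D_1 q z = - 2^-1 * 'D_1 F z := congr1 (@^~ z) (derive1Z _ sF).
have dppE z : 'D_1 (fun y => -1 * 'D_1 p y) z = -1 * 'D_1 ('D_1 p) z :=
  congr1 (@^~ z) (derive1Z _ sp').
change (separated T ('D_1 ('D_1 theta)) p q (t, x)
  + separated T ('D_1 theta) (fun y => -1 * 'D_1 p y) ('D_1 q) (t, x)
  + (separated T ('D_1 theta) (fun y => -1 * 'D_1 p y) ('D_1 q) (t, x)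
    + separated T theta (fun y => -1 * 'D_1 (fun y =>
      -1 * 'D_1 p y) y) ('D_1 ('D_1 q)) (t, x))
  - separated T theta ('D_1 ('D_1 p)) ('D_1 ('D_1 q)) (t, x) =
  'D_1 ('D_1 theta) t * wave F T t x + 2 * 'D_1 theta t * wave_t F T t x).
rewrite /separated /wave /wave_t/= dppE dpE dqE /p /q.
exact: alg.
Qed.

End wave_test_function.

Section weak_form.
Context {R : realType}.
Variables (F : R -> R) (a b c T : R).
Hypothesis HF : primitive_test F a b c.
Variables (theta : R -> R) (alpha beta : R).
Hypotheses (stheta : smooth theta) (alpha0 : 0 < alpha)
  (theta0 : forall t, t <= alpha \/ beta <= t -> theta t = 0).

Lemma test_function_wave : test_function [set z : R * R | 0 < z.1]
  (fun z => theta z.1 * wave F T z.1 z.2).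
Proof.
set phi := fun z : R * R => theta z.1 * _.
(* For t between [alpha] and [beta], |t| is at most |alpha| + |beta|, so [rho] bounds the radius of
   the wave uniformly on the support of [theta]. *)
pose rho := `|a| + `|b| + `|T| + `|alpha| + `|beta|.
have Kc : compact (`[alpha, beta]%classic `*` `[- rho, rho]%classic : set (R * R)).
  by apply: compact_setX; exact: segment_compact.
have Kcl : closed (`[alpha, beta]%classic `*` `[- rho, rho]%classic : set (R * R)).
  rewrite (_ : _ `*` _ = (@fst R R @^-1` `[alpha, beta]) `&` (@snd R R @^-1` `[- rho,
    rho])).
    apply: closedI; apply: closed_comp => //; try exact: itv_closed.
      by move=> z _; exact: cvg_fst.
    by move=> z _; exact: cvg_snd.
  by [].
have supp : closure [set z | phi z != 0] `<=` `[alpha, beta] `*` `[- rho, rho].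
  move/closure_id : Kcl => KE; rewrite [X in _ `<=` X]KE.
  apply: closure_subset => -[t x] /=; rewrite /phi/= => H.
  have [H1 H2] : alpha < t /\ t < beta.
    by split; rewrite ltNge; apply: contra H => ?; rewrite theta0 ?mul0r//;
      [left|right].
  split; rewrite /= in_itv/=; first by rewrite !ltW.
  have tr : wave_radius a b T t <= rho.
    rewrite /wave_radius /rho.
    have := ler_norm beta; have := ler_norm (- alpha); rewrite normrN.
    have := normr_ge0 alpha; have := normr_ge0 beta.
    have -> : `|t| = t by rewrite ger0_norm// ltW// (lt_trans alpha0).
    by lra.
  have H0 : wave F T t x != 0 by apply: contra H => /eqP ->; rewrite mulr0.
  by rewrite !leNgt; apply/andP; split; apply: contra H0 => ?; apply/eqP;
    apply: (wave_supported HF); [left|right]; lra.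
split.
- have [sF _ _ _] := HF.
  by rewrite /phi wave_separated; apply: smooth_separated => //; exact: smoothZ.
- by apply: subclosed_compact Kc supp; exact: closed_closure.
- by move=> z /supp [] /=; rewrite in_itv/= => /andP[+ _] _; exact: lt_le_trans.
Qed.

Lemma wave_equation_test (u : R -> R -> R) : wave_equation u ->
  (forall t, 0 <= t -> in_Lp 2%:E (u t)) ->
  \int[@lebesgue_measure R]_(t in `]0, +oo[)
    ('D_1 ('D_1 theta) t * L2_inner (u t) (wave F T t)
     + 2 * 'D_1 theta t * L2_inner (u t) (wave_t F T t)) = 0.
Proof.
move=> /(_ _ test_function_wave) we Lu; rewrite -[RHS]we.
have [sF _ _ _] := HF.
apply: eq_Rintegral => t; rewrite inE/= in_itv/= andbT => t0.
have Lut := Lu _ (ltW t0).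
have Lw := in_L2_wave T HF t; have Lw' := in_L2_wave_t T HF t.
rewrite -(L2_innerZr _ Lw Lut) -(L2_innerZr _ Lw' Lut).
rewrite /L2_inner -RintegralD//; try by apply: L2_inner_integrable => //; exact: in_L2Z.
apply: eq_Rintegral => x _; rewrite wave_operator_test//.
by rewrite mulrDr.
Qed.

End weak_form.

(** * The du Bois-Reymond lemma *)

Section du_bois_reymond.
Context {R : realType}.
Local Notation mu := (@lebesgue_measure R).
Implicit Types (f g e m S theta : R -> R).

Lemma continuous_within_of_for (A : set R) f :
  (forall t, A t -> {for t, continuous f}) -> {within A, continuous f}.
Proof.
move=> cf; apply/subspace_continuousP => t At.
by apply: cvg_trans (cf t At); apply: cvg_app; exact: cvg_within.
Qed.

Lemma derivable_LRcontinuous (a b : R) f f' : a <= b ->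
  (forall t, t \in `[a, b] -> is_derive t 1 f (f' t)) ->
  derivable_oo_LRcontinuous f a b.
Proof.
move=> ab df.
have cf t : t \in `[a, b] -> {for t, continuous f}.
  move=> /df [dt _].
  exact/differentiable_continuous/derivable1_diffP.
split.
- move=> t tab; have [] // := df t.
  by move: tab; rewrite !in_itv/= => /andP[? ?]; rewrite !ltW.
- by apply: cvg_at_right_filter; apply: cf; rewrite in_itv/= lexx.
- by apply: cvg_at_left_filter; apply: cf; rewrite in_itv/= lexx andbT.
Qed.

Lemma is_derive_line f (t : R) : (forall x, differentiable f x) ->
  is_derive t 1 f ('D_1 f t).
Proof. by move=> df; apply: derivableP; exact/derivable1_diffP. Qed.

Lemma Rintegral_derive f (a b : R) : a < b -> smooth f ->
  \int[mu]_(t in `[a, b]) 'D_1 f t = f b - f a.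
Proof.
move=> ab sf; have df := smooth_differentiable sf.
have ddf := smooth_differentiable (smooth_derive (1 : R) sf).
rewrite /Rintegral (@continuous_FTC2 _ _ f)//.
- by apply: continuous_subspaceT; exact: differentiable_continuous_line.
- apply: (@derivable_LRcontinuous _ _ _ ('D_1 f)); first exact: ltW.
  by move=> t _; exact: is_derive_line.
- by move=> t _; rewrite derive1E.
Qed.

Lemma integrable_continuous f (a b : R) :
  (forall t, t \in `[a, b] -> {for t, continuous f}) ->
  mu.-integrable `[a, b] (EFin \o f).
Proof.
move=> cf; apply: continuous_compact_integrable; first exact: segment_compact.
exact: continuous_within_of_for.
Qed.

(* The dilates d^-1 S'((t - s)/d) of the derivative of a smooth step S form an
   approximate identity at s. *)
Lemma step_approx_identity S m (K s : R) : smooth S ->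
  (forall y, y <= 0 -> S y = 0) -> (forall y, 1 <= y -> S y = 1) ->
  (forall y, `|'D_1 S y| <= K) ->
  (forall t, s <= t -> {for t, continuous m}) ->
  forall eps, 0 < eps -> \forall d \near 0^'+,
    `|\int[mu]_(t in `[s, s + d])
       ('D_1 (fun t => S (d^-1 * t + (- (d^-1 * s)))) t * m t) - m s| <= eps.
Proof.
move=> sS S0 S1 SK cm eps eps0.
have K0 : 0 <= K := le_trans (normr_ge0 _) (SK 0).
have e1 : 0 < eps / (K + 1) by rewrite divr_gt0// ltr_wpDl.
have ms : \forall d \near 0^'+, forall t,
  `|t - s| <= d -> `|m t - m s| <= eps / (K + 1).
  have /cvgrPdist_le/(_ _ e1)[r /= r0 Hr] := cm s (lexx _).
  near=> d => t td; rewrite distrC; apply: Hr; rewrite /ball/= distrC.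
  by apply: le_lt_trans td _; near: d; exact: nbhs_right_lt.
near=> d.
have d0 : 0 < d by near: d; exact: nbhs_right_gt.
have sd : s < s + d by rewrite ltrDl.
pose th t := S (d^-1 * t + (- (d^-1 * s))).
have sth : smooth th by exact: smooth_affine.
have thE t : 'D_1 th t = d^-1 * 'D_1 S (d^-1 * t + (- (d^-1 * s))).
  exact: derive_affine.
have thK t : `|'D_1 th t| <= K / d.
  by rewrite thE normrM (@gtr0_norm _ d^-1) ?invr_gt0// mulrC ler_wpM2r// invr_ge0 ltW.
have cth : continuous ('D_1 th).
  apply: differentiable_continuous_line; apply: smooth_differentiable.
  exact: smooth_derive.
have ith : mu.-integrable `[s, s + d] (EFin \o ('D_1 th)).
  by apply: integrable_continuous => t _; exact: cth.
have cmd t : t \in `[s, s + d] -> {for t, continuous m}.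
  by rewrite in_itv/= => /andP[? _]; exact: cm.
have ithm : mu.-integrable `[s, s + d] (EFin \o (fun t => 'D_1 th t * m t)).
  apply: integrable_continuous => t tI; apply: cvgM; first exact: cth.
  exact: cmd.
have mE : m s = \int[mu]_(t in `[s, s + d]) ('D_1 th t * m s).
  rewrite RintegralZr// Rintegral_derive//.
  have -> : th (s + d) = 1.
    by rewrite /th mulrDr addrAC subrr add0r mulVf ?gt_eqF// S1.
  by rewrite /th subrr S0// subr0 mul1r.
rewrite [X in _ - X]mE -RintegralB//; last first.
  by apply: integrable_continuous => t tI; apply: cvgM; [exact: cth|exact: cvg_cst].
have ii : mu.-integrable `[s, s + d] (EFin \o (fun t =>
  'D_1 th t * m t - 'D_1 th t * m s)).
  apply: integrable_continuous => t tI; apply: cvgB; apply: cvgM; try exact: cth.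
    exact: cmd.
  exact: cvg_cst.
apply: (le_trans (le_normr_Rintegral _ ii)) => //.
apply: (@le_trans _ _ (\int[mu]_(t in `[s, s + d]) (K / d * (eps / (K + 1))))).
  apply: le_Rintegral => //.
  - apply: integrable_continuous => t tI; apply: cvg_norm.
    apply: cvgB; apply: cvgM; try exact: cth; [exact: cmd|exact: cvg_cst].
  - by apply: integrable_continuous => t tI; exact: cvg_cst.
  - move=> t /=; rewrite in_itv/= => /andP[st td].
    rewrite -mulrBr normrM ler_pM//.
    have : forall t, `|t - s| <= d -> `|m t - m s| <= eps / (K + 1) by near: d.
    by apply; rewrite ger0_norm ?subr_ge0// lerBlDl.
rewrite Rintegral_cst//= lebesgue_measure_itv/= lte_fin sd/= addrAC subrr add0r.
rewrite [leLHS](_ : _ = eps * (K / (K + 1))); last by field; lra.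
by rewrite ler_piMr ?(ltW eps0)// ler_pdivrMr ?mul1r ?lerDl// ltr_wpDl.
Unshelve. all: by end_near. Qed.

(** The test function steps up from 0 to 1 just after [s] and back to 0 just after [r]. Its
    derivative is a difference of approximate identities, so the vanishing integral becomes m(s) -
    m(r) = 0 as the width [d] of the steps shrinks. *)
Lemma constant_of_weak_derivative m :
  (forall t, 0 < t -> {for t, continuous m}) ->
  (forall theta (a b : R), smooth theta -> 0 < a -> a < b ->
    (forall t, t <= a \/ b <= t -> 'D_1 theta t = 0) ->
    (forall t, t <= a \/ b <= t -> theta t = 0) ->
    \int[mu]_(t in `[a, b]) ('D_1 theta t * m t) = 0) ->
  forall s r, 0 < s -> s < r -> m s = m r.
Proof.
move=> cm Hm s r s0 sr.
have [S [sS S0 S1 _]] := @smooth_step R.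
have dS0 y : y < 0 \/ 1 < y -> 'D_1 S y = 0.
  move=> [y0|y1].
    apply: (@derive_locally_cst _ _ 0); near=> z; apply: S0; apply/ltW.
    by near: z; exact: lt_nbhsl.
  apply: (@derive_locally_cst _ _ 1); near=> z; apply: S1; apply/ltW.
  by near: z; exact: lt_nbhsr.
have cdS : continuous ('D_1 S).
  apply: differentiable_continuous_line; apply: smooth_differentiable.
  exact: smooth_derive.
have [K HK] := supported_bounded cdS dS0.
have r0 : 0 < r := lt_trans s0 sr.
have cms t : s <= t -> {for t, continuous m}.
  by move=> st; apply: cm; exact: lt_le_trans st.
have cmr t : r <= t -> {for t, continuous m}.
  by move=> rt; apply: cm; exact: lt_le_trans rt.
have approx_s := step_approx_identity sS S0 S1 HK cms.
have approx_r := step_approx_identity sS S0 S1 HK cmr.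
apply/eqP; rewrite -subr_eq0 -normr_eq0; apply/negPn/negP => ne0.
have {}ne0 : 0 < `|m s - m r| by rewrite lt_def ne0 normr_ge0.
(* Two errors of a quarter each add up to less than the whole gap, a contradiction. *)
have e0 : 0 < `|m s - m r| / 4 by rewrite divr_gt0.
have /filter_ex[d [[Hs Hr] [d0 dsr]]] : \forall d \near 0^'+,
  ((`|\int[mu]_(t in `[s, s + d])
       ('D_1 (fun t => S (d^-1 * t + (- (d^-1 * s)))) t * m t) - m s| <= `|m s - m r|
         / 4) /\
  (`|\int[mu]_(t in `[r, r + d])
       ('D_1 (fun t => S (d^-1 * t + (- (d^-1 * r)))) t * m t) - m r| <= `|m s - m r|
         / 4)) /\
  (0 < d /\ d < r - s).
  near=> d; split; split; near: d.
  - exact: approx_s.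
  - exact: approx_r.
  - exact: nbhs_right_gt.
  - by apply: nbhs_right_lt; rewrite subr_gt0.
pose th z t := S (d^-1 * t + (- (d^-1 * z))).
have sth z : smooth (th z) by exact: smooth_affine.
have thE z t : 'D_1 (th z) t = d^-1 * 'D_1 S (d^-1 * t + (- (d^-1 * z))).
  exact: derive_affine.
have argE z t : d^-1 * t + (- (d^-1 * z)) = (t - z) / d.
  by rewrite -mulrBr mulrC.
have dth0 z t : t < z \/ z + d < t -> 'D_1 (th z) t = 0.
  move=> H; rewrite thE dS0 ?mulr0// argE.
  case: H => ?; [left|right].
    by rewrite pmulr_llt0 ?invr_gt0// subr_lt0.
  by rewrite ltr_pdivlMr// mul1r ltrBrDl.
have cdth z : continuous ('D_1 (th z)).
  apply: differentiable_continuous_line; apply: smooth_differentiable.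
  exact: smooth_derive.
(* An interval inside ]0, +oo[ with room on both sides of the two transition zones, so that [theta]
   and its derivative vanish at the ends too. *)
pose a := s / 2; pose b := r + d + 1.
have a0 : 0 < a by rewrite divr_gt0.
have as_ : a < s by rewrite /a; lra.
have ab : a < b by rewrite /b; lra.
pose theta := th s + cst (-1) * th r.
have stheta : smooth theta by apply: smoothD => //; apply: smoothM => //;
  exact: smooth_cst.
have dthetaE t : 'D_1 theta t = 'D_1 (th s) t - 'D_1 (th r) t.
  have dd z : derivable (th z) t 1.
    by apply/derivable1_diffP; exact: smooth_differentiable.
  rewrite /theta deriveD//; last first.
    by apply/derivable1_diffP/smooth_differentiable/smoothM => //; exact: smooth_cst.
  congr (_ + _); rewrite -[RHS]mulN1r -deriveMl//.
have dtheta0 t : t <= a \/ b <= t -> 'D_1 theta t = 0.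
  rewrite /a /b dthetaE => -[ta|bt].
    by rewrite !dth0 ?subrr//; left; move: ta s0 sr; clear; lra.
  by rewrite !dth0 ?subrr//; right; move: bt sr; clear; lra.
have theta0 t : t <= a \/ b <= t -> theta t = 0.
  rewrite /theta /GRing.add/= /GRing.mul/= /th !argE /a /b => -[ta|bt].
    rewrite !S0 ?mulr0 ?addr0// pmulr_lle0 ?invr_gt0// subr_le0; lra.
  by rewrite !S1 ?mulr1 ?subrr// ler_pdivlMr// mul1r; lra.
have := Hm theta a b stheta a0 ab dtheta0 theta0.
have split_int z : a < z -> z + d < b ->
    \int[mu]_(t in `[a, b]) ('D_1 (th z) t * m t) =
    \int[mu]_(t in `[z, z + d]) ('D_1 (th z) t * m t).
  move=> az zb; rewrite [LHS]Rintegral_mkcond [RHS]Rintegral_mkcond.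
  apply: eq_Rintegral => t _; rewrite !patchE; case: ifPn => tab; case: ifPn => tz //.
    rewrite dth0 ?mul0r//; move: tz; rewrite notin_setE/= in_itv/= => /negP.
    by rewrite negb_and -!ltNge => /orP.
  move: tz; rewrite inE/= in_itv/= => /andP[zt tzd].
  move: tab; rewrite notin_setE/= in_itv/= => -[].
  by rewrite (le_trans (ltW az) zt) (le_trans tzd (ltW zb)).
have ith z : mu.-integrable `[a, b] (EFin \o (fun t => 'D_1 (th z) t * m t)).
  apply: integrable_continuous => t; rewrite in_itv/= => /andP[at_ _].
  by apply: cvgM; [exact: cdth|apply: cm; exact: lt_le_trans at_].
rewrite (_ : \int[mu]_(t in _) _ = \int[mu]_(t in `[a, b])
   ('D_1 (th s) t * m t - 'D_1 (th r) t * m t)); last first.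
  by apply: eq_Rintegral => t _; rewrite dthetaE mulrBl.
have ar : a < r := lt_trans as_ sr.
have br : r + d < b by rewrite /b ltrDl.
have bs : s + d < b by apply: lt_trans br; rewrite ltrD2r.
rewrite (RintegralB _ (ith s) (ith r))// (split_int s as_ bs) (split_int r ar br).
move: Hs Hr; rewrite -/(th s) -/(th r).
set As := Rintegral _ _ _; set Ar := Rintegral _ _ _ => Hs Hr /eqP.
rewrite subr_eq0 => /eqP AE; rewrite AE in Hs.
have := ler_distD Ar (m s) (m r); rewrite (distrC (m s) Ar).
move: ne0 Hs Hr; clear; move: `|m s - m r| `|Ar - m s| `|Ar - m r| => x y z.
lra.
Unshelve. all: by end_near. Qed.

End du_bois_reymond.

(** * Pairing a weak solution with a backward wave *)

Section duality.
Context {R : realType}.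
Local Notation mu := (@lebesgue_measure R).

Lemma within_ge0_continuous (f : R -> R) (t : R) : 0 < t ->
  f s @[s --> within `[0, +oo[ (nbhs t)] --> f t -> {for t, continuous f}.
Proof.
move=> t0 cf U /cf; rewrite /nbhs/= /within/= => H.
have Ht : \forall s \near t, 0 < s by exact: lt_nbhsr.
by apply: filterS2 H Ht => s + s0; apply; rewrite in_itv/= andbT ltW.
Qed.

Lemma weak_solution_duality (u ut : R -> R -> R) (F : R -> R) (a b c T : R) :
  L2_curve_continuous u -> L2_curve_continuous ut -> L2_curve_derivative u ut ->
  wave_equation u -> primitive_test F a b c -> 0 < T ->
  L2_inner (u T) ('D_1 F) =
  L2_inner (ut 0) (wave F T 0) - L2_inner (u 0) (wave_t F T 0).
Proof.
move=> cu cut du we HF T0.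
have cW := L2_curve_continuous_wave T HF.
have cW' := L2_curve_continuous_wave_t T HF.
have dW := L2_curve_derivative_wave T HF.
pose e t := L2_inner (u t) (wave F T t).
pose f t := L2_inner (u t) (wave_t F T t).
pose g t := L2_inner (ut t) (wave F T t).
pose m t := g t - f t.
have cf (t : R) : 0 <= t -> f s @[s --> within `[0, +oo[ (nbhs t)] --> f t.
  exact: L2_inner_continuous.
have cg (t : R) : 0 <= t -> g s @[s --> within `[0, +oo[ (nbhs t)] --> g t.
  exact: L2_inner_continuous.
have cfp (t : R) : 0 < t -> {for t, continuous f}.
  by move=> t0; apply: within_ge0_continuous => //; apply: cf; exact: ltW.
have cgp (t : R) : 0 < t -> {for t, continuous g}.
  by move=> t0; apply: within_ge0_continuous => //; apply: cg; exact: ltW.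
have de (t : R) : 0 < t -> is_derive t 1 e (g t + f t).
  by move=> t0; exact: L2_inner_derivative.
have cmp (t : R) : 0 < t -> {for t, continuous m}.
  by move=> t0; apply: cvgB; [exact: cgp|exact: cfp].
(* As e' = g + f, integrating theta'' e by parts turns the tested equation into int theta' (f - g) =
   0: [m] has weak derivative 0. Thus [ut] is never differentiated in time. *)
have mcst (s r : R) : 0 < s -> s < r -> m s = m r.
  apply: constant_of_weak_derivative => // theta al be sth al0 albe dth0 th0.
  have := wave_equation_test T HF sth al0 th0 we (proj1 cu).
  have ddth0 t : t < al \/ be < t -> 'D_1 ('D_1 theta) t = 0.
    move=> [ta|tb]; apply: (@derive_locally_cst _ _ 0); near=> z; apply: dth0;
      [left|right]; apply/ltW; near: z; [exact: lt_nbhsl|exact: lt_nbhsr].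
  have -> : \int[mu]_(t in `]0,
    +oo[) ('D_1 ('D_1 theta) t * e t + 2 * 'D_1 theta t * f t) =
            \int[mu]_(t in `[al, be]) ('D_1 ('D_1 theta) t * e t + 2 * 'D_1 theta t *
              f t).
    rewrite [LHS]Rintegral_mkcond [RHS]Rintegral_mkcond.
    apply: eq_Rintegral => t _; rewrite !patchE; case: ifPn => t0; case: ifPn => tI //.
      have tI' : t < al \/ be < t.
        move: tI; rewrite notin_setE/= in_itv/= => /negP.
        by rewrite negb_and -!ltNge => /orP.
      rewrite ddth0// dth0 ?mul0r ?mulr0 ?mul0r ?addr0//.
      by case: tI'; [left|right]; exact: ltW.
    move: tI; rewrite inE/= in_itv/= => /andP[tl _].
    move: t0; rewrite notin_setE/= in_itv/= => -[].
    by rewrite andbT (lt_le_trans al0).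
  have pos t : t \in `[al, be] -> 0 < t.
    by rewrite in_itv/= => /andP[? _]; exact: lt_le_trans al0 _.
  have ce t : t \in `[al, be] -> {for t, continuous e}.
    move=> /pos /de [dt _].
    exact/differentiable_continuous/derivable1_diffP.
  have ddth := smooth_differentiable (smooth_derive (1 : R) sth).
  have cdth := differentiable_continuous_line ddth.
  have cddth : continuous ('D_1 ('D_1 theta)).
    apply: differentiable_continuous_line; apply: smooth_differentiable.
    by do 2 apply: smooth_derive.
  have i1 : mu.-integrable `[al, be] (EFin \o (fun t => 'D_1 ('D_1 theta) t * e t)).
    by apply: integrable_continuous => t tI; apply: cvgM; [exact: cddth|exact: ce].
  have i2 : mu.-integrable `[al, be] (EFin \o (fun t => 'D_1 theta t * f t)).
    apply: integrable_continuous => t tI; apply: cvgM; first exact: cdth.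
    exact/cfp/pos.
  have i2' : mu.-integrable `[al, be] (EFin \o (fun t => 2 * 'D_1 theta t * f t)).
    apply: integrable_continuous => t tI; apply: cvgM.
      by apply: cvgM; [exact: cvg_cst|exact: cdth].
    exact/cfp/pos.
  have i3 : mu.-integrable `[al, be] (EFin \o (fun t => 'D_1 theta t * (g t + f t))).
    apply: integrable_continuous => t tI; apply: cvgM; first exact: cdth.
    by apply: cvgD; [exact/cgp/pos|exact/cfp/pos].
  rewrite (RintegralD _ i1 i2')//.
  have -> : \int[mu]_(t in `[al, be]) ('D_1 ('D_1 theta) t * e t) =
            - \int[mu]_(t in `[al, be]) ('D_1 theta t * (g t + f t)).
    transitivity (\int[mu]_(t in `[al, be]) (e t * 'D_1 ('D_1 theta) t)).
      by apply: eq_Rintegral => t _; rewrite mulrC.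
    rewrite (@Rintegration_by_parts _ e ('D_1 theta) (fun t => g t + f t))//.
    - rewrite !dth0 ?lexx ?mulr0 ?subrr ?sub0r; [|by left|by right].
      by congr (- _); apply: eq_Rintegral => t _; rewrite mulrC.
    - apply: continuous_within_of_for => t tI.
      by apply: cvgD; [exact/cgp/pos|exact/cfp/pos].
    - apply: (derivable_LRcontinuous (f' := fun t => g t + f t)); first exact: ltW.
      by move=> t /pos; exact: de.
    - move=> t tI; rewrite derive1E.
      have [] // := de t; apply: pos; move: tI; rewrite !in_itv/= => /andP[? ?].
      by rewrite !ltW.
    - by apply: continuous_within_of_for => t _; exact: cddth.
    - apply: (derivable_LRcontinuous (f' := 'D_1 ('D_1 theta))); first exact: ltW.
      by move=> t _; exact: is_derive_line.
    - by move=> t tI; rewrite derive1E.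
  move=> H; transitivity (\int[mu]_(t in `[al,
    be]) ('D_1 theta t * (g t + f t) - 2 * 'D_1 theta t * f t)).
    by apply: eq_Rintegral => t _; rewrite /m; ring.
  by rewrite (RintegralB _ i3 i2')// -[LHS]opprK opprB addrC H oppr0.
(* The test functions only see t > 0; right continuity at 0 of the curves in L^2 brings in the
   initial data. *)
have m0 : m 0 = m T.
  have c0 : m s @[s --> 0^'+] --> m 0.
    have H : m s @[s --> within `[0, +oo[ (nbhs (0 : R))] --> m 0.
      by apply: cvgB; [exact: cg|exact: cf].
    move=> U /H; rewrite /nbhs/= /at_right /within/= => HU.
    apply: filterS HU => s + s0; apply; rewrite in_itv/= andbT; exact: ltW.
  have cT : m s @[s --> 0^'+] --> m T.
    apply: cvg_near_cst; near=> s; apply: mcst.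
      by near: s; exact: nbhs_right_gt.
    by near: s; exact: nbhs_right_lt.
  exact: (cvg_unique _ c0 cT).
have wT : wave F T T = cst 0.
  by apply/funext => x; rewrite /wave subrr addr0 subr0 subrr mul0r.
have wT' : wave_t F T T = fun x => -1 * 'D_1 F x.
  by apply/funext => x; rewrite /wave_t subrr addr0 subr0; field.
move: m0; rewrite /m /g /f wT wT' => ->.
have LF : in_Lp 2%:E ('D_1 F).
  have := in_L2Z (-1) (in_L2_wave_t T HF T); rewrite wT'.
  by congr (in_Lp _ _); apply/funext => x; rewrite mulN1r mulN1r opprK.
rewrite L2_innerZr//; last by apply: (proj1 cu); exact: ltW.
rewrite (_ : L2_inner _ (cst 0) = 0) ?mulN1r ?opprK ?add0r//.
by rewrite /L2_inner; under eq_Rintegral do rewrite mulr0;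
  rewrite Rintegral_cst// mul0r.
Unshelve. all: by end_near. Qed.

End duality.

(** * Translations and vanishing L^2 functions *)

Section translation.
Context {R : realType}.
Local Notation mu := (@lebesgue_measure R).

Lemma measurable_shift (c : R) : measurable_fun setT (fun x : R => x + c).
Proof. by apply: measurable_funD. Qed.

Lemma lebesgue_measure_shift (c : R) (A : set R) : measurable A ->
  pushforward mu (fun x : R => (x + c : measurableTypeR R)) A = mu A.
Proof.
move=> mA; apply/esym/lebesgue_measure_unique => [|mf _ [[a b] _ <-]|//].
  exact: measurable_shift.
rewrite /= /pushforward/=.
rewrite (_ : (fun x => x + c) @^-1` `]a, b] = `]a - c, b - c]%classic); last first.
  by apply/seteqP; split=> x /=; rewrite !in_itv/= ltrBlDr lerBrDr.
rewrite !lebesgue_measure_itv/= !lte_fin ltrD2r; case: ifPn => // _.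
by rewrite -!EFinB; congr EFin; ring.
Qed.

Lemma ge0_integral_shift (f : R -> \bar R) (c : R) :
  measurable_fun setT f -> (forall x, 0 <= f x)%E ->
  (\int[mu]_x f (x + c)%R = \int[mu]_x f x)%E.
Proof.
move=> mf f0.
have := @ge0_integral_pushforward _ _ (measurableTypeR R) (measurableTypeR R) R
  (fun x => x + c) (measurable_shift c) mu setT f measurableT mf (fun y _ => f0 y).
rewrite preimage_setT => <-.
apply: eq_measure_integral => [|mc A mA _]; first exact: measurable_shift.
exact: lebesgue_measure_shift.
Qed.

Lemma integrable_shift (f : R -> R) (c : R) :
  mu.-integrable setT (EFin \o f) ->
  mu.-integrable setT (EFin \o (fun x => f (x + c))).
Proof.
move=> /integrableP[mf fi]; apply/integrableP; split.
  by apply: (measurableT_comp mf); exact: measurable_shift.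
have := ge0_integral_shift (f := fun x => `|(f x)%:E|%E) c.
by rewrite /= => -> //; apply: (@measurableT_comp _ _ _ _ _ _ abse _ (EFin \o f)) =>
  //; exact: mf.
Qed.

Lemma Rintegral_shift (f : R -> R) (c : R) :
  mu.-integrable setT (EFin \o f) ->
  \int[mu]_x f (x + c) = \int[mu]_x f x.
Proof.
move=> fi; have fci := integrable_shift c fi.
rewrite /Rintegral.
have := @integral_pushforward _ _ (measurableTypeR R) (measurableTypeR R) R
  (fun x => x + c) (measurable_shift c) mu setT (EFin \o f).
rewrite preimage_setT => <- //.
- congr fine; apply: eq_measure_integral => [|mc A mA _].
    exact: measurable_shift.
  exact: lebesgue_measure_shift.
- by case/integrableP : fi.
Qed.

End translation.

Section L2_shift.
Context {R : realType}.
Local Notation mu := (@lebesgue_measure R).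

Lemma in_L2_shift (f : R -> R) (c : R) : in_Lp 2%:E f ->
  in_Lp 2%:E (fun x => f (x + c)) /\
  Lp_norm 2%:E (fun x => f (x + c)) = Lp_norm 2%:E f.
Proof.
move=> Lf; have mf := in_Lp_measurable Lf.
have mfc : measurable_fun setT (fun x : R => f (x + c)).
  exact: (measurableT_comp mf (measurable_shift c)).
have i2 := L2_inner_integrable Lf Lf.
have Lfc : in_Lp 2%:E (fun x => f (x + c)).
  apply: in_L2_sqr => //.
  have -> := ge0_integral_shift (f := fun x => (f x ^+ 2)%:E) c.
  - have := Lfun2_integrable_sqr Lf => /integrableP[_].
    by under eq_integral do rewrite /= ger0_norm ?sqr_ge0//.
  - by apply/measurable_EFinP; exact: measurable_funX.
  - by move=> x; rewrite lee_fin sqr_ge0.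
split=> //; apply/eqP.
rewrite -(@eqrXn2 _ 2) ?Lp_norm_ge0// !L2_norm_sqr//; apply/eqP.
exact: (Rintegral_shift c i2).
Qed.

End L2_shift.

(** * Indicators of intervals as limits of test functions *)

Section vanishing.
Context {R : realType}.
Local Notation mu := (@lebesgue_measure R).

(** The derivative of [G] passes smoothly from 0 to 1, and [G] is its primitive in closed form. A
    [primitive_test] can thus be written down directly, without constructing an antiderivative. *)
Lemma smooth_ramp : exists G : R -> R, [/\ smooth G,
  forall y, y <= 0 -> G y = 0 & forall y, 1 <= y -> G y = y].
Proof.
have [S [sS S0 S1 _]] := @smooth_step R.
exists (@id R * S); split; first by apply: smoothM => //; exact: smooth_id.
- by move=> y y0; rewrite /GRing.mul/= S0// mulr0.
- by move=> y y1; rewrite /GRing.mul/= S1// mulr1.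
Qed.

(* F n is a difference of rescaled ramps (y - z)^+, whose derivatives converge
   to the indicators of ]z, +oo[. *)
Lemma indicator_approximation (p q : R) : p < q ->
  exists (F : nat -> R -> R) (K : R),
  [/\ forall n, exists b c, primitive_test (F n) p b c,
    forall n x, `|'D_1 (F n) x| <= K,
    forall n x, x < p \/ q + 1 < x -> 'D_1 (F n) x = 0 &
    forall x, 'D_1 (F n) x @[n --> \oo] --> (\1_(`]p, q]) x : R)].
Proof.
move=> pq; have [G [sG G0 G1]] := smooth_ramp.
have cH : continuous ('D_1 G).
  apply: differentiable_continuous_line; apply: smooth_differentiable.
  exact: smooth_derive.
have H0' y : y < 0 -> 'D_1 G y = 0.
  move=> y0; apply: (@derive_locally_cst _ _ 0); near=> z; apply/G0/ltW.
  by near: z; exact: lt_nbhsl.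
(* The value at y = 0 itself decides which endpoints belong to the limiting indicator: [p] does not
   and [q] does. *)
have H0 y : y <= 0 -> 'D_1 G y = 0.
  rewrite le_eqVlt => /predU1P[->|]; last exact: H0'.
  have c1 : 'D_1 G y @[y --> 0^'-] --> 'D_1 G 0.
    by apply: cvg_at_left_filter; exact: cH.
  have c2 : 'D_1 G y @[y --> 0^'-] --> (0 : R).
    apply: cvg_near_cst; near=> z; apply: H0'.
    by near: z; exact: nbhs_left_lt.
  exact: (cvg_unique _ c1 c2).
have H1 y : 1 < y -> 'D_1 G y = 1.
  move=> y1; rewrite (@near_eq_derive _ _ _ _ id) ?derive_id//.
  near=> z; apply/G1/ltW.
  by near: z; exact: lt_nbhsr.
have [K HK] : exists K, forall y, `|'D_1 G y| <= K.
  have cn : {within `[0, 1], continuous (fun x => `|'D_1 G x|)}.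
    by apply: continuous_subspaceT => x; apply: cvg_norm; exact: cH.
  have [d _ Hd] := EVT_max (@ler01 R) cn.
  exists (`|'D_1 G d| + 1) => y; have [y0|y0] := leP y 0.
    by rewrite H0// normr0 addr_ge0.
  have [y1|y1] := leP y 1.
    by apply: ler_wpDr => //; apply: Hd; rewrite in_itv/= y1 ltW.
  by rewrite H1// normr1 lerDr.
(* Starting at 1 instead of 0 keeps the scale at least 1, so that every transition is over by q + 1
   and all derivatives vanish outside [p, q + 1]. *)
pose N (n : nat) : R := n.+1%:R.
have N0 n : 0 < N n by rewrite ltr0n.
pose A n z x := (N n)^-1 * G (N n * x + - (N n * z)).
pose F n := A n p + cst (-1) * A n q.
have sA n z : smooth (A n z).
  apply: (smoothM (smooth_cst (N n)^-1)); exact: smooth_affine.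
have DA n z x : 'D_1 (A n z) x = 'D_1 G (N n * (x - z)).
  have sB : smooth (fun x => G (N n * x + - (N n * z))) by exact: smooth_affine.
  rewrite -[A n z]/((N n)^-1 \*o (fun x => G (N n * x + - (N n * z)))).
  rewrite deriveMl; last by apply/derivable1_diffP; exact: smooth_differentiable.
  by rewrite derive_affine// mulrA mulVf ?gt_eqF// mul1r mulrBr.
have DF n x : 'D_1 (F n) x = 'D_1 G (N n * (x - p)) - 'D_1 G (N n * (x - q)).
  have dA z : derivable (A n z) x 1.
    by apply/derivable1_diffP; exact: smooth_differentiable.
  have dB : derivable (cst (-1) * A n q) x 1.
    by apply/derivable1_diffP/smooth_differentiable/smoothM => //; exact: smooth_cst.
  rewrite /F (deriveD (dA p) dB) -!DA; congr (_ + _).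
  by rewrite -[RHS]mulN1r -(deriveMl _ (dA q)).
have Nsub n (x z : R) : z <= x -> x - z <= N n * (x - z).
  by move=> zx; rewrite ler_peMl ?subr_ge0// ler1n.
exists F, (K + K); split.
- move=> n; exists (q + 1), (q - p); split.
  + by apply: smoothD => //; apply: smoothM => //; exact: smooth_cst.
  + by move: pq; lra.
  + move=> y yp; rewrite -[F n y]/(A n p y + -1 * A n q y) /A -!mulrBr !G0 ?mulr0
    ?addr0//.
      by rewrite pmulr_rle0// subr_le0 (le_trans yp)// ltW.
    by rewrite pmulr_rle0// subr_le0.
  + move=> y qy; rewrite -[F n y]/(A n p y + -1 * A n q y) /A -!mulrBr.
    rewrite !G1; first by have := N0 n; move: (N n); clear; move=> r r0; field;
      rewrite gt_eqF.
      by apply: le_trans (Nsub n y q _); move: qy; lra.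
    by apply: le_trans (Nsub n y p _); move: qy pq; lra.
- by move=> n x; rewrite DF (le_trans (ler_normB _ _))// lerD.
- move=> n x [xp|qx]; rewrite DF.
    by rewrite !H0 ?subrr// pmulr_rle0// subr_le0 ltW// (lt_trans xp).
  rewrite !H1 ?subrr//.
    by apply: lt_le_trans (Nsub n x q _); move: qx; lra.
  by apply: lt_le_trans (Nsub n x p _); move: qx pq; lra.
- move=> x; have big (z : R) : z < x -> \forall n \near \oo, 1 < N n * (x - z).
    move=> zx; near=> n; rewrite -ltr_pdivrMr ?subr_gt0//.
    apply: (@lt_trans _ _ n%:R); last by rewrite /N ltr_nat.
    by near: n; exact: nbhs_infty_gtr.
  rewrite indicE; have [xp|px] := leP x p.
    apply: cvg_near_cst; near=> n; rewrite DF !H0 ?subrr.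
    + by rewrite memNset//= in_itv/= => /andP[]; rewrite ltNge xp.
    + by rewrite pmulr_rle0// subr_le0 (le_trans xp)// ltW.
    + by rewrite pmulr_rle0// subr_le0.
  have bp := big p px.
  have [xq|qx] := leP x q.
    apply: cvg_near_cst; near=> n.
    rewrite DF (H0 (_ * (x - q))) ?pmulr_rle0// ?subr_le0// subr0 H1.
      by rewrite mem_set//= in_itv/= px.
    by near: n.
  have bq := big q qx.
  apply: cvg_near_cst; near=> n; rewrite DF !H1 ?subrr.
  + by rewrite memNset//= in_itv/= => /andP[_]; rewrite leNgt qx.
  + by near: n.
  + by near: n.
Unshelve. all: by end_near. Qed.

End vanishing.

Lemma integrable_patch {R : realType} (f : R -> R) (D : set R) :
  measurable D ->
  (@lebesgue_measure R).-integrable D (EFin \o f) <->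
  (@lebesgue_measure R).-integrable setT (EFin \o (f \_ D)).
Proof.
move=> mD; rewrite -restrict_EFin; exact: integrable_mkcond.
Qed.

(** * Square integrable functions orthogonal to all test functions *)

Section L2_vanishing.
Context {R : realType}.
Local Notation mu := (@lebesgue_measure R).
Variable w : R -> R.
Hypothesis Lw : in_Lp 2%:E w.

Lemma in_L2_indic (a b : R) : in_Lp 2%:E (\1_(`[a, b]) : R -> R).
Proof.
have [ab|ba] := leP a b.
  apply: (@proj1 _ _ (@L2_supported _ _ 1 a b _ ab _ _)).
  - exact: measurable_indic.
  - by move=> x; rewrite indicE; case: (_ \in _); rewrite ?normr1 ?normr0.
  - move=> x H; rewrite indicE memNset//= in_itv/= => /andP[].
    by case: H; rewrite ltNge => /negbTE ->.
rewrite set_itv_ge ?bnd_simp -?ltNge//.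
apply: (@proj1 _ _ (@L2_supported _ _ 0 0 0 _ (lexx _) _ _)) => //.
- by move=> x; rewrite indicE in_set0 normr0.
- by move=> x _; rewrite indicE in_set0.
Qed.

Lemma L2_integrable_itv (a b : R) : mu.-integrable `[a, b] (EFin \o w).
Proof.
have := L2_inner_integrable Lw (in_L2_indic a b).
move=> H; apply/(integrable_patch _ (measurable_itv _)); move: H.
congr (integrable _ _ (EFin \o _)); apply/funext => x.
by rewrite patchE indicE; case: ifPn => xI; rewrite ?mulr1 ?mulr0.
Qed.

Hypothesis Hw : forall (F : R -> R) (a b c : R), primitive_test F a b c ->
  L2_inner w ('D_1 F) = 0.

Lemma L2_vanishing_itv (p q : R) : p < q -> \int[mu]_(x in `[p, q]) w x = 0.
Proof.
move=> pq; have [F [K [HF HK supp lim]]] := indicator_approximation pq.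
have mw := in_Lp_measurable Lw.
have mDF n : measurable_fun setT ('D_1 (F n)).
  have [b [c [sF _ _ _]]] := HF n.
  apply: continuous_measurable_fun; apply: differentiable_continuous_line.
  by apply: smooth_differentiable; exact: smooth_derive.
(* A function in L^2 need not be integrable on the line, but it is on bounded intervals; the common
   support of the derivatives permits this cut-off majorant. *)
pose g := fun x : R => (K%:E * `|((w \_ `[p, (q + 1)%R]) x)%:E|)%E.
have ig : mu.-integrable setT g.
  apply: integrableZl => //; apply: integrable_abse.
  by apply/(integrable_patch _ (measurable_itv _)); exact: L2_integrable_itv.
have mfn n : measurable_fun setT (fun x => (w x * 'D_1 (F n) x)%:E).
  by apply/measurable_EFinP; exact: measurable_funM.
have mf : measurable_fun setT (fun x => (w x * \1_(`]p, q]) x)%:E).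
  by apply/measurable_EFinP; apply: measurable_funM.
have flim : {ae mu, forall x, setT x ->
    (w x * 'D_1 (F n) x)%:E @[n --> \oo] --> (w x * \1_(`]p, q]) x)%:E}.
  apply: nearW => x _; apply: cvg_EFin; first exact: nearW.
  by apply: cvgM; [exact: cvg_cst|exact: lim].
have fle : {ae mu, forall x (n : nat), setT x ->
    (`|(w x * 'D_1 (F n) x)%:E| <= g x)%E}.
  apply: nearW => x n _; rewrite /g/= -EFinM lee_fin normrM patchE.
  have K0 := le_trans (normr_ge0 _) (HK 0%N 0).
  case: ifPn => [_|]; first by rewrite mulrC ler_wpM2r.
  rewrite notin_setE/= in_itv/= => /negP; rewrite negb_and -!ltNge => /orP H.
  by rewrite supp// normr0 mulr0 mulr_ge0.
have [_ _ /=] := @dominated_convergence _ _ R mu setT measurableT _ _ g mfn mf flim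
  ig fle.
have zero n : (\int[mu]_x (w x * 'D_1 (F n) x)%:E = 0)%E.
  have [b [c Fn]] := HF n.
  have LF : in_Lp 2%:E ('D_1 (F n)).
    have := in_L2Z (-1) (in_L2_wave_t 0 Fn 0).
    congr (in_Lp _ _); apply/funext => x.
    by rewrite /wave_t !subr0 addr0; field.
  have := Hw Fn; rewrite /L2_inner /Rintegral => H.
  by rewrite -[LHS]fineK ?H//; apply: integrable_fin_num => //;
    exact: L2_inner_integrable.
under eq_fun do rewrite zero.
move=> cv0; have E0 := cvg_unique (@ereal_hausdorff R) cv0 (cvg_cst 0%E).
rewrite -Rintegral_itv_obnd_cbnd; last first.
  by apply: integrableS (L2_integrable_itv p q) => //; exact: subset_itv_oc_cc.
rewrite /Rintegral integral_mkcond (_ : integral _ _ _ = 0%E)//.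
rewrite -[RHS]E0; apply: eq_integral => x _.
by rewrite patchE indicE; case: ifPn => xI; rewrite ?mulr1 ?mulr0.
Qed.

(** Truncating [w] to [-N, N] makes it integrable on the line. Its indefinite integral from -oo is
    then identically 0, since [w] integrates to 0 over intervals, and Lebesgue differentiation
    recovers the truncation almost everywhere. *)
Lemma L2_vanishing : {ae mu, forall x, w x = 0}.
Proof.
pose wN (N : nat) := w \_ `[- N%:R, N%:R]%classic.
have iwN N : mu.-integrable setT (EFin \o wN N).
  by apply/(integrable_patch _ (measurable_itv _)); exact: L2_integrable_itv.
have FE N x : \int[mu]_(t in `]-oo, x]) wN N t = 0.
  rewrite /wN -Rintegral_mkcondr.
  rewrite (_ : _ `&` _ = `[- N%:R, Num.min x N%:R]%classic); last first.
    apply/seteqP; split => t /=; rewrite !in_itv/= le_min.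
      by move=> [-> /andP[-> ->]].
    by move=> /and3P[-> -> ->].
  have [xN|Nx|<-] := ltgtP (Num.min x N%:R) (- N%:R).
  - by rewrite set_itv_ge ?Rintegral_set0// bnd_simp -ltNge.
  - exact: L2_vanishing_itv.
  - by rewrite set_itv1 Rintegral_set1.
have aeN N : {ae mu, forall x, wN N x = 0}.
  have locN : locally_integrable setT (wN N).
    by apply: open_integrable_locally => //; exact: openT.
  have iN y : mu.-integrable `]-oo, y] (EFin \o wN N).
    by apply: (integrableS _ _ _ (iwN N)).
  have := FTC1Ny iN locN.
  apply: (@filterS _ _ (ae_filter_ringOfSetsType mu)) => x [_ <-].
  rewrite (_ : (fun x => _) = cst 0) ?derive1_cst//.
  by apply/funext => y; rewrite FE.
have : {ae mu, forall x, forall N, wN N x = 0} by apply: ae_foralln => N; exact: aeN.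
apply: (@filterS _ _ (ae_filter_ringOfSetsType mu)) => x /(_ (Num.trunc `|x|).+1).
rewrite /wN patchE ifT// inE/= in_itv/= -ler_norml ltW//.
exact: truncnS_gt.
Qed.

End L2_vanishing.

(** * Fubini on a band around the diagonal *)

Section band.
Context {R : realType}.
Local Notation mu := (@lebesgue_measure R).
Variable T : R.
Hypothesis T0 : 0 <= T.

Definition band : set (R * R) := [set z | z.2 \in `[z.1 - T, z.1 + T]].

Lemma band_sym x y : band (x, y) <-> band (y, x).
Proof.
by rewrite /band/= !in_itv/=; split => /andP[? ?]; apply/andP; split; lra.
Qed.

Lemma measurable_band : measurable band.
Proof.
have -> : band = (fun z : R * R => z.2 - z.1) @^-1` `[- T, T].
  apply/seteqP; split => z; rewrite /band/= !in_itv/= => /andP[? ?];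
    by apply/andP; split; lra.
rewrite -[X in measurable X]setTI.
apply: (measurable_funB (f := snd) (g := fst)) => //; exact: measurable_itv.
Qed.

Variables (f : R -> R) (k : R * R -> R) (K : R).
Hypotheses (fi : mu.-integrable setT (EFin \o f)) (mk : measurable_fun setT k)
  (kK : forall z, `|k z| <= K) (kband : forall z, ~ band z -> k z = 0).

Let K0 : 0 <= K. Proof. exact: le_trans (normr_ge0 _) (kK (0, 0)). Qed.

Let mf : measurable_fun setT f.
Proof. by move/integrableP : fi => [/measurable_EFinP]. Qed.

Let mkx x : measurable_fun setT (fun y => k (x, y)).
Proof. exact: measurableT_comp mk (measurable_pair1 x). Qed.

Let mky y : measurable_fun setT (fun x => k (x, y)).
Proof. exact: measurableT_comp mk (measurable_pair2 y). Qed.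

Lemma integral_band_le x :
  (\int[mu]_y `|k (x, y)|%:E <= (K * (2 * T))%:E)%E.
Proof.
have -> : (\int[mu]_y `|k (x, y)|%:E =
    \int[mu]_(y in `[(x - T)%R, (x + T)%R]) `|k (x, y)|%:E)%E.
  rewrite [RHS]integral_mkcond; apply: eq_integral => y _.
  rewrite patchE; case: ifPn => //.
  by rewrite notin_setE => ?; rewrite kband// normr0.
apply: (@le_trans _ _ (\int[mu]_(y in `[(x - T)%R, (x + T)%R]) K%:E)%E).
  apply: ge0_le_integral => //.
  - by apply/measurable_EFinP; apply: measurableT_comp => //;
    apply: measurable_funTS; exact: mkx.
  - by move=> y _; rewrite lee_fin.
rewrite integral_cst//= lebesgue_measure_itv/= lte_fin.
case: ifPn => _; last by rewrite mule0 lee_fin mulr_ge0// mulr_ge0.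
by rewrite -EFinB -EFinM lee_fin (_ : x + T - (x - T) = 2 * T)//; ring.
Qed.

Lemma integrable_band x : mu.-integrable setT (EFin \o (fun y => k (x, y))).
Proof.
apply/integrableP; split; first by apply/measurable_EFinP; exact: mkx.
by apply: le_lt_trans (integral_band_le x) (ltry _).
Qed.

Lemma integrable_band_mul y :
  mu.-integrable setT (EFin \o (fun x => f x * k (x, y))).
Proof.
have fK : mu.-integrable setT (fun x => K%:E * `|(f x)%:E|)%E.
  by apply: integrableZl => //; exact: integrable_abse.
apply: le_integrable fK => //.
  by apply/measurable_EFinP; apply: measurable_funM => //; exact: mky.
move=> x _; rewrite /= lee_fin !normrM normr_id (ger0_norm K0) mulrC.
by rewrite ler_wpM2r.
Qed.

Let h (z : R * R) := (f z.1 * k z)%:E.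

Let mh : measurable_fun setT h.
Proof.
apply/measurable_EFinP; apply: measurable_funM => //.
exact: measurableT_comp mf measurable_fst.
Qed.

(** Sections of the band have length 2 T, so Tonelli bounds the double integral of |f k| by 2 T K
    times the L^1 norm of [f]. *)
Lemma integrable_band_prod : (mu \x mu)%E.-integrable setT h.
Proof.
apply/integrable12ltyP => //.
apply: (@le_lt_trans _ _ (\int[mu]_x ((K * (2 * T))%:E * `|(f x)%:E|))%E).
  apply: ge0_le_integral => //.
  - by move=> x _; exact: integral_ge0.
  - apply: (measurable_fun_fubini_tonelli_F (m2 := mu) (fun z => `|h z|%E)) => //.
    exact: measurableT_comp.
  - apply: emeasurable_funM => //; apply/measurableT_comp => //.
    exact/measurable_EFinP.
  - move=> x _; rewrite /h/=.
    under eq_integral do rewrite /= normrM EFinM.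
    rewrite ge0_integralZl//; last first.
      by apply/measurable_EFinP; apply: measurableT_comp => //; exact: mkx.
    by rewrite muleC lee_wpmul2r//; exact: integral_band_le.
rewrite ge0_integralZl//.
- by rewrite lte_mul_pinfty// ?lee_fin ?mulr_ge0//; case/integrableP : fi.
- by apply/measurableT_comp => //; exact/measurable_EFinP.
- by rewrite lee_fin mulr_ge0// mulr_ge0.
Qed.

(** Meant for two kernels: the indicator of the band, which gives the integral of a window, and the
    indicator times F'(y), which gives the pairing of a window with F'. *)
Lemma band_fubini :
  [/\ mu.-integrable setT (EFin \o (fun y => \int[mu]_x (f x * k (x, y)))) &
  \int[mu]_x (f x * \int[mu]_y k (x, y)) =
  \int[mu]_y (\int[mu]_x (f x * k (x, y)))].
Proof.
have GE y : fubini_G mu h y = (\int[mu]_x (f x * k (x, y)))%:E.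
  rewrite /Rintegral fineK//; apply: integrable_fin_num => //.
  exact: integrable_band_mul.
have FE x : fubini_F mu h x = (f x * \int[mu]_y k (x, y))%:E.
  rewrite -RintegralZl//; last exact: integrable_band.
  rewrite /Rintegral fineK//; apply: integrable_fin_num => //.
  by apply: (integrableZl _ (f x) (integrable_band x)).
split.
  (* Exchanging the variables turns the marginal in y into a marginal of the first kind. *)
  have ih : (mu \x mu)%E.-integrable setT (fun z => h (z.2, z.1)).
    apply/integrable12ltyP; first exact: (measurableT_comp mh (measurable_swap (T1 :=
      R) (T2 := R))).
    exact: (integrable21ltyP mu mu mh).1 integrable_band_prod.
  have := integrable_fubini_F ih.
  by apply: eq_integrable => // y _; rewrite -[LHS]/(fubini_G mu h y) GE.
have := Fubini integrable_band_prod.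
rewrite /Rintegral => H; congr fine.
transitivity (\int[mu]_x fubini_F mu h x)%E.
  by apply: eq_integral => x _; rewrite FE.
by rewrite [LHS]H; apply: eq_integral => y _; rewrite -GE.
Qed.

End band.

(** * Integrals over a moving interval *)

Section window.
Context {R : realType}.
Local Notation mu := (@lebesgue_measure R).
Variable T : R.
Hypothesis T0 : 0 <= T.
Implicit Types f : R -> R.

(** The convolution of [f] with the indicator of [-T, T]; half of it is the [u1] term of
    d'Alembert's formula. *)
Definition window f (y : R) : R := \int[mu]_(x in `[y - T, y + T]) f x.

Let ind : R * R -> R := \1_(band T).

Let mind : measurable_fun setT ind.
Proof. by apply: measurable_indic; exact: measurable_band. Qed.

Let ind_le1 z : `|ind z| <= 1.
Proof. by rewrite /ind indicE; case: (_ \in _); rewrite ?normr1 ?normr0. Qed.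

Let ind_band z : ~ band T z -> ind z = 0.
Proof. by move=> Hz; rewrite /ind indicE memNset. Qed.

Lemma mul_indic_band f x y :
  f x * \1_(band T) (x, y) = (f \_ `[y - T, y + T]) x.
Proof.
rewrite patchE indicE; have [xy|xy] := boolP (x \in _).
  by rewrite mem_set ?mulr1//; apply/band_sym; move: xy; rewrite inE.
rewrite memNset ?mulr0// => /band_sym H; move: xy.
by rewrite notin_setE; apply.
Qed.

Lemma window_band f y : \int[mu]_x (f x * \1_(band T) (x, y)) = window f y.
Proof.
rewrite /window [RHS]Rintegral_mkcond; apply: eq_Rintegral => x _.
exact: mul_indic_band.
Qed.

Lemma Rintegral_indic_band x : \int[mu]_y (\1_(band T) (x, y) : R) = 2 * T.
Proof.
transitivity (\int[mu]_(y in `[x - T, x + T]) (1 : R)).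
  rewrite [RHS]Rintegral_mkcond; apply: eq_Rintegral => y _.
  rewrite patchE indicE; have [xy|xy] := boolP (y \in [set` _]).
    by rewrite mem_set//; move: xy; rewrite inE.
  by rewrite memNset// => H; move: xy; rewrite notin_setE; apply.
rewrite Rintegral_cst//= mul1r lebesgue_measure_itv/= lte_fin.
case: ltP => [_|TT] /=; first by ring.
by have := T0; lra.
Qed.

Lemma window_integrable f : mu.-integrable setT (EFin \o f) ->
  mu.-integrable setT (EFin \o window f).
Proof.
move=> fi; have [+ _] := band_fubini T0 fi mind ind_le1 ind_band.
by apply: eq_integrable => // y _; rewrite /= window_band.
Qed.

Lemma Rintegral_window f : mu.-integrable setT (EFin \o f) ->
  \int[mu]_y window f y = 2 * T * \int[mu]_x f x.
Proof.
move=> fi; have [_ H] := band_fubini T0 fi mind ind_le1 ind_band.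
under eq_Rintegral do rewrite -window_band.
rewrite -H mulrC -RintegralZr//.
by apply: eq_Rintegral => x _; rewrite Rintegral_indic_band.
Qed.

Lemma Lp_norm1 f : Lp_norm 1%E f = \int[mu]_x `|f x|.
Proof. by rewrite /Lp_norm Lnorm1. Qed.

(** A case of Young's convolution inequality: pointwise, |window f|^2 is at most the L^1 norm of [f]
    times the window of |f|, and that window has integral 2 T times the same norm. Hence the growth
    like the square root of [T]. *)
Lemma L2_window f : in_Lp 1%E f -> in_Lp 2%:E (window f) /\
  Lp_norm 2%:E (window f) <= Num.sqrt (2 * T) * Lp_norm 1%E f.
Proof.
move=> Lf; have fi : mu.-integrable setT (EFin \o f) by exact/Lfun1_integrable.
have ai : mu.-integrable setT (EFin \o (fun x => `|f x|)) := integrable_abse fi.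
pose a x := `|f x|.
have fitv y : mu.-integrable `[y - T, y + T] (EFin \o f).
  by apply: integrableS fi.
have aitv y : mu.-integrable `[y - T, y + T] (EFin \o a).
  by apply: integrableS ai.
have wa y : `|window f y| <= window a y by exact: le_normr_Rintegral.
have A0 := Lp_norm_ge0 1%E f.
have wA y : window a y <= Lp_norm 1%E f.
  rewrite Lp_norm1 /window [leLHS]Rintegral_mkcond; apply: le_Rintegral => //.
    by apply/(integrable_patch _ (measurable_itv _)); exact: aitv.
  by move=> x _; rewrite patchE; case: ifPn => //; rewrite /a normr_ge0.
have iw := window_integrable ai.
have mw : measurable_fun setT (window f).
  by move/integrableP : (window_integrable fi) => [/measurable_EFinP].
have sq : (\int[mu]_x (window f x ^+ 2)%:E <= (2 * T * Lp_norm 1%E f ^+ 2)%:E)%E.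
  apply: (@le_trans _ _ (\int[mu]_x ((Lp_norm 1%E f)%:E * (window a x)%:E))%E).
    apply: ge0_le_integral => //.
    - by move=> x _; rewrite lee_fin sqr_ge0.
    - by apply/measurable_EFinP; exact: measurable_funX.
    - apply/measurable_EFinP; apply: measurable_funM => //.
      by move/integrableP : iw => [/measurable_EFinP].
    - move=> x _; rewrite -EFinM lee_fin -[leLHS]ger0_norm ?sqr_ge0// normrX expr2.
      by rewrite ler_pM// (le_trans (wa x)).
  rewrite integralZl//.
  have := Rintegral_window ai; rewrite -/a -Lp_norm1 => H.
  have -> : (\int[mu]_x (window a x)%:E = (2 * T * Lp_norm 1%E f)%:E)%E.
    by rewrite -H /Rintegral fineK//; exact: integrable_fin_num.
  by rewrite -EFinM lee_fin expr2 mulrA [leLHS]mulrC.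
have Lw : in_Lp 2%:E (window f).
  by apply: in_L2_sqr => //; exact: le_lt_trans sq (ltry _).
split=> //; rewrite -(@ler_pXn2r _ 2) ?nnegrE ?mulr_ge0 ?Lp_norm_ge0//.
rewrite L2_norm_sqr// exprMn sqr_sqrtr ?mulr_ge0//.
rewrite -lee_fin; apply: le_trans sq.
rewrite /L2_inner /Rintegral fineK//.
by apply: integrable_fin_num => //; exact: L2_inner_integrable.
Qed.

(** The difference of [F] is the integral of F' over [x - T, x + T]. Fubini then exchanges the
    variables, and by symmetry of the band the interval moves from F' to [f]. *)
Lemma window_duality f (F : R -> R) (a b c : R) : in_Lp 1%E f ->
  primitive_test F a b c ->
  \int[mu]_x (f x * (F (x + T) - F (x - T))) =
  L2_inner (window f) ('D_1 F).
Proof.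
move=> Lf HF; have fi : mu.-integrable setT (EFin \o f) by exact/Lfun1_integrable.
have [K HK] := primitive_test_bounds HF.
have [sF _ _ _] := HF.
have mD : measurable_fun setT ('D_1 F).
  apply: continuous_measurable_fun; apply: differentiable_continuous_line.
  by apply: smooth_differentiable; exact: smooth_derive.
pose k z := ind z * 'D_1 F z.2.
have mk : measurable_fun setT k.
  apply: measurable_funM => //; exact: measurableT_comp mD measurable_snd.
have kK z : `|k z| <= K.
  have [_ H _] := HK z.2; rewrite /k normrM.
  by apply: le_trans H; rewrite ler_piMl.
have kb z : ~ band T z -> k z = 0 by move=> Hz; rewrite /k ind_band ?mul0r.
have [_ H] := band_fubini T0 fi mk kK kb.
transitivity (\int[mu]_x (f x * \int[mu]_y k (x, y))).
  apply: eq_Rintegral => x _; congr (_ * _).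
  transitivity (\int[mu]_(y in `[x - T, x + T]) 'D_1 F y).
    have := T0; rewrite le_eqVlt => /predU1P[<-|T1].
      by rewrite subr0 addr0 subrr set_itv1 Rintegral_set1.
    by rewrite Rintegral_derive//; lra.
  rewrite [LHS]Rintegral_mkcond; apply: eq_Rintegral => y _.
  rewrite /k /ind patchE indicE; have [xy|xy] := boolP (y \in [set` _]).
    by rewrite mem_set ?mul1r//; move: xy; rewrite inE.
  by rewrite memNset ?mul0r// => B; move: xy; rewrite notin_setE; apply.
rewrite H; apply: eq_Rintegral => y _.
rewrite -window_band -RintegralZr//.
  by apply: eq_Rintegral => x _; rewrite /k/= mulrA.
exact: integrable_band_mul fi mind ind_le1 y.
Qed.

End window.

(** * d'Alembert's formula *)

Section dalembert.
Context {R : realType}.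
Local Notation mu := (@lebesgue_measure R).
Local Notation n2 := (Lp_norm 2%:E).
Implicit Types f g h : R -> R.

Lemma L2_inner_ae f g h : in_Lp 2%:E f -> in_Lp 2%:E g -> in_Lp 2%:E h ->
  {ae mu, forall x, f x = g x} -> L2_inner f h = L2_inner g h.
Proof.
move=> Lf Lg Lh fg; congr fine; apply: ae_eq_integral => //.
- by have /integrableP[] := L2_inner_integrable Lf Lh.
- by have /integrableP[] := L2_inner_integrable Lg Lh.
- by apply: (@filterS _ _ (ae_filter_ringOfSetsType mu)) fg => x /= -> _.
Qed.

Lemma L2_norm_ae f g : in_Lp 2%:E f -> in_Lp 2%:E g ->
  {ae mu, forall x, f x = g x} -> n2 f = n2 g.
Proof.
move=> Lf Lg fg; apply/eqP.
rewrite -(@eqrXn2 _ 2) ?Lp_norm_ge0// !L2_norm_sqr//.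
by rewrite (L2_inner_ae Lf Lg Lf fg) L2_innerC (L2_inner_ae Lf Lg Lg fg).
Qed.

Definition dalembert (u0 u1 : R -> R) (T x : R) : R :=
  2^-1 * (u0 (x + T) + u0 (x + - T)) + 2^-1 * window T u1 x.

(** The duality identity and the formula have the same pairing with every F': the [u0] terms agree
    by translation, the [u1] terms by [window_duality]. The difference is therefore orthogonal to
    all test functions. *)
Lemma dalembert_ae (u0 u1 : R -> R) (u : R -> R -> R) (T : R) :
  in_Lp 2%:E u0 -> in_Lp 2%:E u1 -> in_Lp 1%E u1 -> weak_solution u0 u1 u ->
  0 < T -> {ae mu, forall x, u T x = dalembert u0 u1 T x}.
Proof.
move=> Lu0 L2u1 L1u1 [ux [ut [[cu _ _] [cut du] we u0E u1E]]] T0.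
have [Lup nup] := in_L2_shift T Lu0; have [Lum num] := in_L2_shift (- T) Lu0.
have [Lw _] := L2_window (ltW T0) L1u1.
have le12 := @le1_2E R.
have Ls : in_Lp 2%:E (fun x => 2^-1 * (u0 (x + T) + u0 (x + - T))).
  by apply: (in_L2Z _ (in_LpD le12 Lup Lum)).
have LV : in_Lp 2%:E (fun x => 2^-1 * window T u1 x) by exact: in_L2Z.
have Ld : in_Lp 2%:E (dalembert u0 u1 T) := in_LpD le12 Ls LV.
have LuT : in_Lp 2%:E (u T) by apply: (proj1 cu); exact: ltW.
have Lwd : in_Lp 2%:E (u T \- dalembert u0 u1 T) by exact: in_LpB.
suff : {ae mu, forall x, (u T \- dalembert u0 u1 T) x = 0}.
  apply: (@filterS _ _ (ae_filter_ringOfSetsType mu)) => x /=.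
  by move/eqP; rewrite subr_eq0 => /eqP.
apply: L2_vanishing => // F a b c HF.
have LF : in_Lp 2%:E ('D_1 F).
  have := in_L2Z (-1) (in_L2_wave_t 0 HF 0).
  congr (in_Lp _ _); apply/funext => x.
  by rewrite /wave_t !subr0 addr0; field.
have LW := in_L2_wave T HF 0; have LW' := in_L2_wave_t T HF 0.
have Lu_0 : in_Lp 2%:E (u 0) by apply: (proj1 cu).
have Lut_0 : in_Lp 2%:E (ut 0) by apply: (proj1 cut).
rewrite L2_innerBl// (weak_solution_duality cu cut du we HF T0).
rewrite (L2_inner_ae Lut_0 L2u1 LW u1E) (L2_inner_ae Lu_0 Lu0 LW' u0E).
have LFs (z : R) := proj1 (in_L2_shift z LF).
have shiftE (z : R) : L2_inner (fun x => u0 (x + z)) ('D_1 F) =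
    L2_inner u0 (fun x => 'D_1 F (x + - z)).
  rewrite /L2_inner -[RHS](Rintegral_shift z); last first.
    exact: L2_inner_integrable (LFs (- z)).
  by apply: eq_Rintegral => x _; rewrite -addrA subrr addr0.
have E1 : L2_inner u1 (wave F T 0) = 2^-1 * L2_inner (window T u1) ('D_1 F).
  rewrite -(window_duality (ltW T0) L1u1 HF) -RintegralZl//; last first.
    have := L2_inner_integrable L2u1 (in_L2Z 2 LW).
    congr (integrable _ _ (EFin \o _)); apply/funext => x.
    by rewrite /wave subr0; field.
  by apply: eq_Rintegral => x _; rewrite /wave subr0; field.
have E2 : - L2_inner u0 (wave_t F T 0) =
    2^-1 * (L2_inner (fun x => u0 (x + T)) ('D_1 F) +
            L2_inner (fun x => u0 (x + - T)) ('D_1 F)).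
  rewrite !shiftE opprK.
  have LA := LFs (- T); have LB := LFs T.
  have -> : wave_t F T 0 = (fun x => - 2^-1 *
     ((fun x => 'D_1 F (x + - T)) \+ (fun x => 'D_1 F (x + T))) x).
    by apply/funext => x; rewrite /wave_t subr0/=; ring.
  rewrite L2_innerZr//; last exact: in_LpD.
  rewrite /L2_inner -RintegralD//; try exact: L2_inner_integrable.
  rewrite mulNr opprK; congr (_ * _).
  by apply: eq_Rintegral => x _; rewrite mulrDr.
have -> : L2_inner (dalembert u0 u1 T) ('D_1 F) =
    2^-1 * (L2_inner (fun x => u0 (x + T)) ('D_1 F) +
            L2_inner (fun x => u0 (x + - T)) ('D_1 F)) +
    2^-1 * L2_inner (window T u1) ('D_1 F).
  rewrite -(L2_innerZl _ Lw LF).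
  have DD f g : in_Lp 2%:E f -> in_Lp 2%:E g ->
      L2_inner (f \+ g) ('D_1 F) = L2_inner f ('D_1 F) + L2_inner g ('D_1 F).
    move=> Lf Lg; rewrite /L2_inner -RintegralD//; try exact: L2_inner_integrable.
    by apply: eq_Rintegral => x _; rewrite mulrDl.
  rewrite -(DD _ _ Lup Lum) -(L2_innerZl _ (in_LpD le12 Lup Lum) LF).
  by rewrite -DD.
by rewrite E1 E2 [X in X - _]addrC subrr.
Qed.

Lemma L2_normZ f (a : R) : 0 <= a -> in_Lp 2%:E f ->
  n2 (fun x => a * f x) = a * n2 f.
Proof.
move=> a0 Lf; have Laf := in_L2Z a Lf; apply/eqP.
rewrite -(@eqrXn2 _ 2) ?mulr_ge0 ?Lp_norm_ge0// exprMn !L2_norm_sqr//.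
by rewrite L2_innerZl// L2_innerZr// mulrA expr2.
Qed.

(** * Growth of the window norm *)

Lemma L2_norm_ge f (m a b : R) : in_Lp 2%:E f -> 0 <= m -> a < b ->
  (forall x, x \in `[a, b] -> m <= `|f x|) -> m * Num.sqrt (b - a) <= n2 f.
Proof.
move=> Lf m0 ab mf; have ba0 : 0 <= b - a by rewrite subr_ge0 ltW.
rewrite -(@ler_pXn2r _ 2) ?nnegrE ?mulr_ge0 ?Lp_norm_ge0//.
rewrite exprMn sqr_sqrtr// L2_norm_sqr//.
have -> : m ^+ 2 * (b - a) = \int[mu]_(x in `[a, b]) (m ^+ 2).
  by rewrite Rintegral_cst//= lebesgue_measure_itv/= lte_fin ab.
rewrite Rintegral_mkcond; apply: le_Rintegral => //.
- apply/(integrable_patch _ (measurable_itv _)).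
  by apply: integrable_continuous => t _; exact: cvg_cst.
- exact: L2_inner_integrable.
- move=> x _; rewrite patchE; case: ifPn => [|_]; last by rewrite -expr2 sqr_ge0.
  rewrite inE => /mf mfx; rewrite -expr2 -[leRHS]ger0_norm ?sqr_ge0// normrX.
  by rewrite ler_pXn2r ?nnegrE.
Qed.

(** The remainders outside [-n, n] tend to 0 in L^1 by dominated convergence. Uniformity in [a] and
    [b] holds because enlarging the interval only decreases the remainder pointwise. *)
Lemma L1_tail f : mu.-integrable setT (EFin \o f) -> forall eps, 0 < eps ->
  exists n : nat, forall a b : R, a <= - n%:R -> n%:R <= b ->
  `|\int[mu]_(x in `[a, b]) f x - \int[mu]_x f x| <= eps.
Proof.
move=> fi eps eps0.
have mf : measurable_fun setT f by move/integrableP : fi => [/measurable_EFinP].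
pose r (n : nat) x := f x - (f \_ `[- n%:R, n%:R]%classic) x.
have ip (a b : R) : mu.-integrable setT (EFin \o (f \_ `[a, b]%classic)).
  by apply/(integrable_patch _ (measurable_itv _)); apply: integrableS fi.
have ri n : mu.-integrable setT (EFin \o r n).
  by apply: (integrableB _ fi (ip _ _)).
have rle n x : `|r n x| <= `|f x|.
  by rewrite /r patchE; case: ifPn => _; rewrite ?subrr ?normr0 ?subr0.
have mr n : measurable_fun setT (fun x => `|r n x|%:E).
  by have /integrableP[+ _] := integrable_abse (ri n).
have lim : {ae mu, forall x, setT x -> `|r n x|%:E @[n --> \oo] --> 0%:E}.
  apply: nearW => x _; apply: cvg_near_cst; near=> n.
  rewrite /r patchE ifT ?subrr ?normr0// inE/= in_itv/= -ler_norml.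
  by near: n; exact: nbhs_infty_ger.
have bd : {ae mu, forall x (n : nat),
  setT x -> (`| `|r n x|%:E | <= (abse \o (EFin \o f)) x)%E}.
  by apply: nearW => x n _; rewrite /= normr_id lee_fin.
have [_ _ /=] := @dominated_convergence _ _ R mu setT measurableT
  (fun n x => `|r n x|%:E) (fun=> 0%:E) (abse \o (EFin \o f)) mr (measurable_cst _)
    lim (integrable_abse fi) bd.
rewrite integral0 => /fine_cvgP[_ /cvgrPdist_le/(_ _ eps0)[n _ Hn]].
exists n => a b an nb; have := Hn n (leqnn n); rewrite /= sub0r normrN.
rewrite Rintegral_mkcond -RintegralB//.
apply: le_trans.
have ii : mu.-integrable setT (EFin \o (fun x => (f \_ `[a, b]%classic) x - f x)).
  by apply: (integrableB _ (ip _ _) fi).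
apply: (le_trans (le_normr_Rintegral _ ii)) => //.
apply: le_trans (ler_norm _); apply: le_Rintegral => //.
- exact: integrable_abse ii.
- exact: integrable_abse (ri n).
- move=> x _; rewrite /r !patchE.
  case: ifPn => xab; first by rewrite subrr normr0.
  rewrite ifN ?subr0 ?sub0r ?normrN//; apply: contra xab.
  rewrite !inE/= !in_itv/= => /andP[nx xn].
  by rewrite (le_trans an)// (le_trans xn).
Unshelve. all: by end_near. Qed.

Lemma window_norm_lower f : in_Lp 1%E f ->
  exists2 t0 : R, 0 < t0 & forall t, t0 <= t ->
    2^-1 * `|\int[mu]_x f x| * Num.sqrt t <= n2 (window t f).
Proof.
move=> Lf; have fi : mu.-integrable setT (EFin \o f) by exact/Lfun1_integrable.
(* A zero integral is set apart since the tail estimate needs a positive tolerance, here half of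
   |P|. *)
set P := Rintegral _ _ _; have [->|P0] := eqVneq P 0.
  by exists 1 => // t _; rewrite normr0 mulr0 mul0r Lp_norm_ge0.
have hP : 0 < 2^-1 * `|P| by rewrite mulr_gt0// normr_gt0.
have [n Hn] := L1_tail fi hP.
(* For |x| <= t/2 the interval [x - t, x + t] contains [-t/2, t/2], hence [-n, n]; the added 1 keeps
   the threshold positive when n = 0. *)
exists (2 * n%:R + 1) => [|t tn]; first by rewrite ltr_wpDl// mulr_ge0.
have n0 : 0 <= n%:R :> R by exact: ler0n.
have t0 : 0 < t by lra.
have [Lw _] := L2_window (ltW t0) Lf.
have := @L2_norm_ge (window t f) (2^-1 * `|P|) (- (t / 2)) (t / 2) Lw (ltW hP).
rewrite (_ : t / 2 - - (t / 2) = t); last by field.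
apply; first by lra.
move=> x; rewrite in_itv/= => /andP[x1 x2].
have := Hn (x - t) (x + t); rewrite -/(window t f x) -/P => H.
have {}H : `|window t f x - P| <= 2^-1 * `|P| by apply: H; lra.
have := ler_distD (window t f x) P 0; rewrite !subr0 distrC.
by move: H; clear; lra.
Qed.

End dalembert.

(** * Upper and lower estimates for the solution *)

Theorem theorem1p1 (R : realType) :
  exists C1 C2 : R,
  [/\ 0 < C1, 0 < C2
    & forall u0 u1 : R -> R, in_H1 u0 -> in_Lp 2%:E u1 ->
      forall u : R -> R -> R, weak_solution u0 u1 u ->
        (in_Lp 1%E u0 -> in_Lp 1%E u1 ->
         exists2 t0 : R, 0 < t0 & forall t : R, t0 <= t ->
           Lp_norm 2%:E (u t) <= C1 * I01 u0 u1 * Num.sqrt t)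
        /\
        (in_Lp 1%E u0 -> in_L11 u1 ->
         exists2 t0 : R, 0 < t0 & forall t : R, t0 <= t ->
           C2 * `|\int[@lebesgue_measure R]_x u1 x| * Num.sqrt t
             <= Lp_norm 2%:E (u t))].
Proof.
(* For t >= 1, ||u0|| is at most ||u0|| sqrt t, and half of sqrt (2 t) is at most sqrt t, whence 1.
   In the lower bound half of the window contributes 1/4, and half of that is spent on absorbing
   ||u0||, whence 1/8. *)
exists 1, (8^-1); split=> // u0 u1 [Lu0 _] Lu1 u wu.
have LuT t : 0 <= t -> in_Lp 2%:E (u t).
  by move=> t0; have [ux [ut [[[Lu _] _ _] _ _ _ _]]] := wu; exact: Lu.
have le12 := @le1_2E R.
pose s t x := 2^-1 * (u0 (x + t) + u0 (x + - t)).
have Ls t : in_Lp 2%:E (s t) /\ Lp_norm 2%:E (s t) <= Lp_norm 2%:E u0.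
  have [Lup nup] := in_L2_shift t Lu0; have [Lum num] := in_L2_shift (- t) Lu0.
  have Lsum := in_LpD le12 Lup Lum.
  split; first exact: (in_L2Z _ Lsum).
  rewrite (L2_normZ _ Lsum)//.
  have := Lp_normD le12 Lup Lum; rewrite nup num.
  by move: (Lp_norm _ _) (Lp_norm _ _) => p q; lra.
(* Both inequalities are the triangle inequality for u = s + V/2, with the norm of [s t] at most
   that of [u0]. *)
have key t : in_Lp 1%E u1 -> 0 < t -> exists V, [/\ V = window t u1,
    in_Lp 2%:E V, Lp_norm 2%:E (u t) <= Lp_norm 2%:E u0 + 2^-1 * Lp_norm 2%:E V &
    2^-1 * Lp_norm 2%:E V <= Lp_norm 2%:E (u t) + Lp_norm 2%:E u0].
  move=> L1u1 t0; have [Ls1 Ls2] := Ls t; have Lut := LuT _ (ltW t0).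
  have [LV _] := L2_window (ltW t0) L1u1; exists (window t u1); split=> //.
    have LhV := in_L2Z 2^-1 LV.
    rewrite (L2_norm_ae Lut (in_LpD le12 Ls1 LhV) (dalembert_ae Lu0 Lu1 L1u1 wu t0)).
    rewrite -(L2_normZ _ LV)//.
    by apply: (le_trans (Lp_normD le12 Ls1 LhV)); rewrite lerD2r.
  have LhV := in_L2Z 2^-1 LV; rewrite -(L2_normZ _ LV)//.
  rewrite (L2_norm_ae (g := u t \- s t) LhV); last 2 first.
  - exact: in_LpB.
  - apply: (@filterS _ _ (ae_filter_ringOfSetsType _)) (dalembert_ae Lu0 Lu1 L1u1 wu
    t0).
    by move=> x /= ->; rewrite /dalembert /s [X in X - _]addrC addrK.
  apply: (le_trans (Lp_normD le12 Lut (in_LpN Ls1))).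
  by rewrite Lp_normN lerD2l.
split=> [L1u0 L1u1|L1u0 [L1u1 _]].
  exists 1 => // t t1; have t0 : 0 < t := lt_le_trans ltr01 t1.
  have [V [-> _ ub _]] := key t L1u1 t0.
  have [_ wub] := L2_window (ltW t0) L1u1.
  have st1 : 1 <= Num.sqrt t by rewrite -[leLHS](@sqrtr1 R) ler_wsqrtr.
  have s2 : Num.sqrt (2 * t) <= 2 * Num.sqrt t.
    rewrite -(@ler_pXn2r _ 2) ?nnegrE ?mulr_ge0 ?sqrtr_ge0// exprMn.
    by rewrite !sqr_sqrtr ?mulr_ge0 ?(ltW t0)//; lra.
  rewrite mul1r /I01; apply: (le_trans ub).
  have h1 := Lp_norm_ge0 2%:E u0; have h2 := Lp_norm_ge0 1%E u0.
  have h3 := Lp_norm_ge0 2%:E u1; have h4 := Lp_norm_ge0 1%E u1.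
  move: (Lp_norm 2%:E u0) (Lp_norm 1%E u0) (Lp_norm 2%:E u1) (Lp_norm 1%E u1) h1 h2
    h3 h4 wub.
  move: (Num.sqrt t) (Num.sqrt (2 * t)) (Lp_norm _ _) st1 s2; clear.
  move=> r q v r1 qr a b c d a0 b0 c0 d0 vd.
  have : q * d <= 2 * r * d by rewrite ler_wpM2r.
  have : a <= a * r by rewrite ler_peMr.
  have : 0 <= b * r by rewrite mulr_ge0//; lra.
  have : 0 <= c * r by rewrite mulr_ge0//; lra.
  by rewrite !mulrDl; lra.
have [t0 t00 Ht0] := window_norm_lower L1u1.
(* For a zero integral the lower bound is trivial; otherwise |P| may appear in the denominator of
   the threshold. *)
set P := Rintegral _ _ _ in Ht0 *; have [P0|P0] := eqVneq P 0.
  by exists 1 => // t _; rewrite P0 normr0 mulr0 mul0r Lp_norm_ge0.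
have nP : 0 < `|P| by rewrite normr_gt0.
(* The time from which 8 ||u0|| <= |P| sqrt t holds, so that 1/4 |P| sqrt t - ||u0|| is at least 1/8
   |P| sqrt t. It depends on the data, as the threshold may. *)
pose t1 := (8 * Lp_norm 2%:E u0 / `|P|) ^+ 2.
exists (t0 + t1) => [|t tt]; first by rewrite ltr_pwDl// sqr_ge0.
have t10 : 0 <= t1 by exact: sqr_ge0.
have tt0 : t0 <= t by apply: le_trans tt; rewrite lerDl.
have [V [-> _ _ lb]] := key t L1u1 (lt_le_trans t00 tt0).
have lb2 := Ht0 t tt0.
have st : 8 * Lp_norm 2%:E u0 <= `|P| * Num.sqrt t.
  rewrite [leRHS]mulrC -ler_pdivrMr//.
  have q0 : 0 <= 8 * Lp_norm 2%:E u0 / `|P|.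
    by rewrite divr_ge0// mulr_ge0// Lp_norm_ge0.
  rewrite -(ger0_norm q0) -sqrtr_sqr ler_wsqrtr//.
  by apply: le_trans tt; rewrite lerDr ltW.
move: lb lb2 st; rewrite -!mulrA.
move: (`|P| * _) (Lp_norm 2%:E u0) (Lp_norm _ (u t)) (Lp_norm _ _); clear.
by move=> x a b c; lra.
Qed.
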